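(* Let $k>0$. Consider the cylindrical ($\nu=1$) isotropic Euler-Poisson equations $$r\,n_t+(nur)_r=0,\qquad u_t+uu_r=-k\phi_r,\qquad (r\phi_r)_r=-nr,\qquad r>0,\ t>0,$$ with initial data $(n,u)(r,0)=(n_0,u_0)(r)$, $n_0\ge0$, $u_0>0$. The smooth solution breaks down in finite time if $$\exists\,\alpha\in\mathbb{R}^+\quad\text{s.t.}\quad u_0'(\alpha)\le-\sqrt{2kn_0(\alpha)}.$$
   Context: Initial data: $n_0,u_0\in C^1(\mathbb{R}^+)$. With $E=-\phi_r$, it is required that $Er$ vanish at $r=0$, i.e. $E(r,t)\,r=\int_0^r n(\xi,t)\xi\,d\xi$. ''Breaks down'' means that $n$ and $u_r$ become unbounded along a particle path $\frac{d}{dt}r(\alpha,t)=u(r(\alpha,t),t)$, $r(\alpha,0)=\alpha$, in finite time (equivalently $\partial r/\partial\alpha$ vanishes).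
   Formalization: The point α is also required not to satisfy both u_0'(α)=0 and n_0=0 on (0,α]; without this the claim fails, e.g. n_0=0, u_0=1 has the global smooth solution n=0, u=1. *)

(* Defs.v *)
From Stdlib Require Import Reals.
From Coquelicot Require Import Coquelicot.
Open Scope R_scope.

(* C^1 on the closed half line [0, +oo): the derivative on (0, +oo) extends
   continuously to 0. *)
Definition continuous_on_half_line (f : R -> R) : Prop :=
  forall r, 0 <= r ->
    filterlim f (within (fun x => 0 <= x) (locally r)) (locally (f r)).

Definition C1_half_line (f : R -> R) : Prop :=
  continuous_on_half_line f /\
  exists df : R -> R,
    continuous_on_half_line df /\ forall r, 0 < r -> is_derive f r (df r).

(* Functions of (r, t) are total; only their values on the strip
   [0, +oo) x [0, T) matter. *)
Definition strip (T : R) (p : R * R) : Prop :=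
  0 <= fst p /\ 0 <= snd p < T.

Definition continuous_on_strip (T : R) (f : R -> R -> R) : Prop :=
  forall p, strip T p ->
    filterlim (fun q : R * R => f (fst q) (snd q))
      (within (strip T) (locally p)) (locally (f (fst p) (snd p))).

Definition C1_strip (T : R) (f : R -> R -> R) : Prop :=
  continuous_on_strip T f /\
  exists fr ft : R -> R -> R,
    continuous_on_strip T fr /\ continuous_on_strip T ft /\
    forall r t, 0 < r -> 0 < t < T ->
      is_derive (fun x => f x t) r (fr r t) /\
      is_derive (fun s => f r s) t (ft r t).

(* Smooth solution, on the time interval [0, T), of
     r n_t + (n u r)_r = 0,   u_t + u u_r = - k phi_r,   (r phi_r)_r = - n r.
   The last clause is the requirement that E r vanish at r = 0, where
   E = - phi_r. *)
Definition smooth_solution (k : R) (n0 u0 : R -> R) (T : R)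
    (n u phi : R -> R -> R) : Prop :=
  0 < T /\
  C1_strip T n /\ C1_strip T u /\
  (forall r, 0 <= r -> n r 0 = n0 r /\ u r 0 = u0 r) /\
  (forall r t, 0 < r -> 0 < t < T ->
     ex_derive (fun x => phi x t) r /\
     r * Derive (fun s => n r s) t + Derive (fun x => n x t * u x t * x) r = 0 /\
     Derive (fun s => u r s) t + u r t * Derive (fun x => u x t) r
       = - k * Derive (fun x => phi x t) r /\
     is_derive (fun x => x * Derive (fun y => phi y t) x) r (- n r t * r) /\
     - Derive (fun x => phi x t) r * r = RInt (fun xi => n xi t * xi) 0 r).

(* X a t is the position r(a, t) of the particle that starts at a > 0. *)
Definition particle_paths (u : R -> R -> R) (T : R) (X : R -> R -> R) : Prop :=
  forall a, 0 < a ->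
    X a 0 = a /\
    filterlim (X a) (at_right 0) (locally a) /\
    (forall t, 0 < t < T -> 0 < X a t /\ is_derive (X a) t (u (X a t) t)).

(* A smooth solution conserves E r along each particle path, so the particle
   starting at a obeys r'' = k E with E = (int_0^a n0 xi dxi) / r.  These
   trajectories are determined by the initial data alone, for all times, also
   when a smooth solution ends earlier because of some other particle; they are
   used to name the time at which the paths near a given one collide. *)
Definition trajectories (k : R) (n0 u0 : R -> R) (X : R -> R -> R) : Prop :=
  forall a, 0 < a ->
    X a 0 = a /\
    filterlim (X a) (at_right 0) (locally a) /\
    filterlim (Derive (X a)) (at_right 0) (locally (u0 a)) /\
    (forall t, 0 < t ->
       0 < X a t /\ ex_derive (X a) t /\
       is_derive (Derive (X a)) t (k * (RInt (fun xi => n0 xi * xi) 0 a / X a t))).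

Definition unbounded_before (T : R) (f : R -> R) : Prop :=
  forall M, exists t, 0 < t < T /\ M < Rabs (f t).

(* The derivative dr/da (a, .) is positive before time Tb and vanishes at Tb;
   no smooth solution lives beyond Tb; and if one lives up to Tb, then u_r and n
   become unbounded along the path from a as t tends to Tb.  If n0 a = 0, then n
   is identically 0 along that path, hence the guard on n. *)
Definition breaks_down_along (k : R) (n0 u0 : R -> R) (X : R -> R -> R)
    (a Tb : R) : Prop :=
  (forall t, 0 <= t <= Tb -> ex_derive (fun b => X b t) a) /\
  (forall t, 0 <= t < Tb -> 0 < Derive (fun b => X b t) a) /\
  Derive (fun b => X b Tb) a = 0 /\
  (forall (T : R) (n u phi : R -> R -> R),
     smooth_solution k n0 u0 T n u phi ->
     T <= Tb /\
     particle_paths u T X /\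
     (T = Tb ->
        unbounded_before Tb (fun t => Derive (fun x => u x t) (X a t)) /\
        (0 < n0 a -> unbounded_before Tb (fun t => n (X a t) t)))).

Definition breaks_down_in_finite_time (k : R) (n0 u0 : R -> R) : Prop :=
  exists X : R -> R -> R,
    trajectories k n0 u0 X /\
    exists a Tb : R, 0 < a /\ 0 < Tb /\ breaks_down_along k n0 u0 X a Tb.

(* Main.v *)
(* Write m(a) = int_0^a n0 xi dxi.  The particle from a obeys r'' = k m(a) / r, whence the
   energy identity (r')^2 = u0(a)^2 + 2 k m(a) ln (r / a), and z = ln (r / a) is found by
   inverting
     t = a * int_0^z e^s / sqrt (u0(a)^2 + 2 k m(a) s) ds,
   which is C^1 in (a, z).  The Jacobian J = dr/da satisfies J(0) = 1, J'(0) = u0'(a) and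
     J'' = k n0(a) a / r - k m(a) J / r^2.
   Since r >= a, as long as J > 0 this gives J <= 1 + u0' t + k n0 t^2 / 2, and the
   threshold condition says that this quadratic has a positive root (when u0' = 0, J is
   strictly concave and reaches 0 because m(a) > 0).  So J has a first zero Tb.

   For a smooth solution let N(r, t) = int_0^r n xi dxi; mass conservation reads
   N_t = - n u r.  Along the trajectory r(a, .) the defects u - r' and N - m(a) solve a
   homogeneous linear system with zero initial data, so both vanish by Gronwall.
   Differentiating u(r(a, t), t) = r'(a, t) and N(r(a, t), t) = m(a) in a gives u_r J = J'
   and n r J = n0(a) a: as J -> 0, u_r and n cannot stay bounded. *)

Require Import Defs.
From Stdlib Require Import Reals Lra Psatz ClassicalEpsilon.
From Coquelicot Require Import Coquelicot.
Open Scope R_scope.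

(** * Calculus *)

Lemma Rabs_lt_ball (x y e : R) : Rabs (y - x) < e -> ball x e y.
Proof. exact (fun H => H). Qed.

Lemma continuous_at_right (f : R -> R) x :
  continuous f x -> filterlim f (at_right x) (locally (f x)).
Proof.
intros H. apply (filterlim_filter_le_1 (F := locally x)); [apply filter_le_within|exact H].
Qed.

(** Derivatives are available only for positive times, so at [a] just a right limit is assumed: the
    mean value theorem gives the inequality on [[x, b]], and then [x] tends to [a]. *)
Lemma derive_nonneg_le (f df : R -> R) a b :
  a < b -> filterlim f (at_right a) (locally (f a)) ->
  (forall x, a < x <= b -> is_derive f x (df x)) ->
  (forall x, a < x <= b -> 0 <= df x) -> f a <= f b.
Proof.
intros Hab Hlim Hd Hp.
assert (Hx : forall x, a < x < b -> f x <= f b).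
{ intros x Hx.
  destruct (MVT_cor2 f df x b) as [c [Hc1 Hc2]]; [lra| |].
  - intros c Hc. apply is_derive_Reals, Hd. lra.
  - assert (0 <= df c) by (apply Hp; lra). nra. }
apply (@filterlim_le _ (at_right a) _ f (fun _ => f b) (f a) (f b)).
- exists (mkposreal (b - a) ltac:(lra)). intros y Hy Hy'.
  apply Hx.
  unfold ball in Hy; simpl in Hy; unfold AbsRing_ball, abs, minus, plus, opp in Hy; simpl in Hy.
  apply Rabs_def2 in Hy. lra.
- exact Hlim.
- apply filterlim_const.
Qed.

Lemma derive_nonpos_ge (f df : R -> R) a b :
  a < b -> filterlim f (at_right a) (locally (f a)) ->
  (forall x, a < x <= b -> is_derive f x (df x)) ->
  (forall x, a < x <= b -> df x <= 0) -> f b <= f a.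
Proof.
intros Hab Hlim Hd Hp.
enough (- f a <= - f b) by lra.
apply (derive_nonneg_le (fun x => - f x) (fun x => - df x) a b Hab).
- exact (filterlim_comp _ _ _ f Ropp _ _ _ Hlim (filterlim_opp (f a))).
- intros x Hx. apply (is_derive_opp f x (df x)). now apply Hd.
- intros x Hx. specialize (Hp x Hx). lra.
Qed.

(** The product [f t * exp (- C * t)] is nonincreasing and starts at 0. *)
Lemma gronwall_zero (f df : R -> R) C T :
  0 < T -> filterlim f (at_right 0) (locally (f 0)) -> f 0 = 0 ->
  (forall t, 0 < t <= T -> is_derive f t (df t)) ->
  (forall t, 0 < t <= T -> df t <= C * f t) -> f T <= 0.
Proof.
intros HT Hl H0 Hd Hb.
assert (H : f T * exp (- C * T) <= f 0 * exp (- C * 0)).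
{ apply (derive_nonpos_ge (fun t => f t * exp (- C * t))
    (fun t => df t * exp (- C * t) + f t * (- C * exp (- C * t))) 0 T HT).
  - eapply (filterlim_comp_2 f (fun t => exp (- C * t)) Rmult).
    + exact Hl.
    + apply (continuous_at_right (fun t => exp (- C * t))).
      apply (ex_derive_continuous (fun t => exp (- C * t))). auto_derive; auto.
    + apply (filterlim_mult (f 0) (exp (- C * 0))).
  - intros t Ht. specialize (Hd t Ht).
    evar_last.
    + apply (is_derive_mult f (fun t => exp (- C * t))); [exact Hd| |exact Rmult_comm].
      auto_derive; reflexivity.
    + unfold plus, mult; simpl. ring.
  - intros t Ht. specialize (Hb t Ht).
    assert (0 < exp (- C * t)) by apply exp_pos. nra. }
rewrite H0, Rmult_0_l in H.
assert (0 < exp (- C * T)) by apply exp_pos. nra.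
Qed.

(** The zero is the supremum of all [x] such that [f] is positive on [[0, x]]; continuity at the
    supremum excludes both signs there. *)
Lemma first_zero (f : R -> R) t1 :
  (forall t, continuous f t) -> 0 < f 0 -> 0 < t1 -> f t1 <= 0 ->
  exists t0, 0 < t0 /\ f t0 = 0 /\ forall t, 0 <= t < t0 -> 0 < f t.
Proof.
intros Hc H0 Ht1 Hf1.
pose (E := fun x => 0 <= x /\ forall y, 0 <= y <= x -> 0 < f y).
destruct (completeness E) as [s [Hub Hlub]].
- exists t1. intros x [Hx Hy]. apply Rnot_lt_le. intros Hlt.
  specialize (Hy t1 ltac:(lra)). lra.
- exists 0. split; [lra|]. intros y Hy. now replace y with 0 by lra.
- assert (Hs0 : 0 <= s).
  { apply Hub. split; [lra|]. intros y Hy. now replace y with 0 by lra. }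
  assert (Hlt : forall y, 0 <= y < s -> 0 < f y).
  { intros y Hy. apply Rnot_le_lt. intros Hle.
    assert (s <= y); [|lra].
    apply Hlub. intros x [Hx Hxx]. apply Rnot_lt_le. intros Hyx.
    specialize (Hxx y ltac:(lra)). lra. }
  assert (Hle : f s <= 0).
  { apply Rnot_lt_le. intros Hpos.
    destruct (Hc s _ (open_gt 0 _ Hpos)) as [e He].
    pose proof (cond_pos e) as He0.
    assert (s + e / 2 <= s); [|lra].
    apply Hub. split; [lra|].
    intros y Hy. destruct (Rlt_le_dec y s) as [Hys|Hys]; [apply Hlt; lra|].
    apply He, Rabs_lt_ball. apply Rabs_def1; lra. }
  assert (Hs : 0 < s).
  { destruct Hs0 as [|<-]; [assumption|lra]. }
  exists s. split; [exact Hs|]. split; [|exact Hlt].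
  apply Rle_antisym; [exact Hle|].
  apply Rnot_lt_le. intros Hneg.
  destruct (Hc s _ (open_lt 0 _ Hneg)) as [e He].
  pose proof (cond_pos e) as He0.
  (* The maximum with 0 keeps the point close to [s] inside [[0, s)], where [f] is positive. *)
  assert (Hm : 0 <= Rmax 0 (s - e / 2) < s).
  { unfold Rmax; destruct Rle_dec; lra. }
  specialize (Hlt _ Hm).
  assert (f (Rmax 0 (s - e / 2)) < 0); [|lra].
  apply He, Rabs_lt_ball.
  apply Rabs_def1; [lra|]. unfold Rmax in *; destruct Rle_dec; lra.
Qed.

(** Differentiability of [f] at the point follows when one partial derivative exists nearby and is
    continuous at the point, while the other exists at the point alone. *)
Lemma is_derive_comp_2 (f fx : R -> R -> R) (fy : R) (x y : R -> R) (t dx dy : R) :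
  locally (x t, y t) (fun q => is_derive (fun z => f z (snd q)) (fst q) (fx (fst q) (snd q))) ->
  is_derive (f (x t)) (y t) fy ->
  continuous (fun q : R * R => fx (fst q) (snd q)) (x t, y t) ->
  is_derive x t dx -> is_derive y t dy ->
  is_derive (fun s => f (x s) (y s)) t (dx * fx (x t) (y t) + dy * fy).
Proof.
intros H1 H2 H3 Hx Hy.
pose proof (is_derive_filterdiff f (x t) (y t) fx fy H1 H2 H3) as H.
pose proof (filterdiff_comp'_2 x y f t _ _
  (fun a b : R => plus (scal a (fx (x t) (y t))) (scal b fy)) Hx Hy H) as HH.
apply (filterdiff_ext_lin _ _ _ HH).
intros s. unfold scal, plus; simpl; unfold mult; simpl. ring.
Qed.

(** A positive derivative at the single point [p] keeps the difference quotients based at [p]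
    positive nearby. It says nothing of monotonicity around [p]. *)
Lemma is_derive_pos_sign (f : R -> R) (p l : R) :
  is_derive f p l -> 0 < l ->
  locally p (fun q : R => (p < q -> f p < f q) /\ (q < p -> f q < f p)).
Proof.
intros H Hl. apply is_derive_Reals in H.
destruct (H (l / 2) ltac:(lra)) as [d Hd].
exists d. intros q Hq. change R in q.
assert (Hq' : Rabs (q - p) < d) by exact Hq.
destruct (Req_dec q p) as [->|Hne]; [split; lra|].
specialize (Hd (q - p) ltac:(lra) Hq').
replace (p + (q - p)) with q in Hd by ring.
apply Rabs_def2 in Hd.
assert (E : f q - f p = (f q - f p) / (q - p) * (q - p)) by (field; lra).
assert (0 < (f q - f p) / (q - p)) by lra.
split; intros; nra.
Qed.

(* Continuity of [zeta] is not needed: by monotonicity of [F], [zeta q] is trapped between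
   the lines of slopes [d - e] and [d + e] through [(p, zeta p)], where [d = - Fp / Fz]. *)
Lemma is_derive_implicit (F Fz : R -> R -> R) (Fp c : R) (zeta : R -> R) (p : R) :
  locally (zeta p, p)
    (fun q => is_derive (fun z => F z (snd q)) (fst q) (Fz (fst q) (snd q))) ->
  is_derive (F (zeta p)) p Fp ->
  continuous (fun q : R * R => Fz (fst q) (snd q)) (zeta p, p) ->
  0 < Fz (zeta p) p ->
  locally p (fun q : R => F (zeta q) q = c /\ forall x y, x <= y -> F x q <= F y q) ->
  is_derive zeta p (- Fp / Fz (zeta p) p).
Proof.
intros H1 H2 H3 Hz Hloc.
set (d := - Fp / Fz (zeta p) p).
assert (Hc : F (zeta p) p = c) by (apply locally_singleton in Hloc; apply Hloc).
(* Along the line of slope [d + e] the chain rule gives [(d + e) * Fz + Fp], and [d] is chosen so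
   that [d * Fz + Fp = 0]. *)
assert (Hphi : forall e, is_derive (fun q => F (zeta p + (d + e) * (q - p)) q) p
                           (e * Fz (zeta p) p)).
{ intros e.
  assert (E0 : zeta p + (d + e) * (p - p) = zeta p) by ring.
  evar_last.
  - apply (is_derive_comp_2 F Fz Fp (fun q => zeta p + (d + e) * (q - p)) (fun q => q) p (d + e) 1).
    + now rewrite E0.
    + now rewrite E0.
    + now rewrite E0.
    + auto_derive; auto; ring.
    + apply (is_derive_id p).
  - simpl. rewrite E0. unfold d. field. lra. }
apply is_derive_Reals. intros e He.
assert (Hup := is_derive_pos_sign _ _ _ (Hphi (e / 2)) ltac:(nra)).
assert (Hdn := is_derive_pos_sign _ _ _
  (is_derive_opp _ _ _ (Hphi (- (e / 2)))) ltac:(unfold opp; simpl; nra)).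
unfold opp in Hdn; simpl in Hdn.
destruct (filter_and _ _ Hloc (filter_and _ _ Hup Hdn)) as [del Hdel].
exists del. intros h Hh0 Hh.
assert (Hb : ball p del (p + h)).
{ unfold ball; simpl; unfold AbsRing_ball, abs, minus, plus, opp; simpl.
  now replace (p + h + - p) with h by ring. }
destruct (Hdel _ Hb) as [[Hq Hmono] [[U1 U2] [D1 D2]]].
replace (zeta p + (d + e / 2) * (p - p)) with (zeta p) in * by ring.
replace (zeta p + (d + - (e / 2)) * (p - p)) with (zeta p) in * by ring.
replace (p + h - p) with h in * by ring.
rewrite Hc in *.
(* Since [F] at [zeta (p + h)] equals [c], monotonicity turns a comparison of values of [F] with [c]
   into a comparison of arguments with [zeta (p + h)]. *)
assert (L : forall x, F x (p + h) < c -> x < zeta (p + h)).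
{ intros x Hx. apply Rnot_le_lt. intros Hle. specialize (Hmono _ _ Hle). lra. }
assert (G : forall x, c < F x (p + h) -> zeta (p + h) < x).
{ intros x Hx. apply Rnot_le_lt. intros Hle. specialize (Hmono _ _ Hle). lra. }
assert (E : (zeta (p + h) - zeta p) / h - d = (zeta (p + h) - (zeta p + d * h)) / h)
  by (field; lra).
rewrite E.
assert (E' : (zeta (p + h) - (zeta p + d * h)) / h * h = zeta (p + h) - (zeta p + d * h))
  by (field; lra).
set (r := _ / h) in *. clearbody r.
destruct (Rdichotomy _ _ Hh0) as [Hn|Hp].
- specialize (U2 ltac:(lra)). specialize (D2 ltac:(lra)).
  apply L in U2. apply Ropp_lt_cancel, G in D2.
  apply Rabs_def1; nra.
- specialize (U1 ltac:(lra)). specialize (D1 ltac:(lra)).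
  apply G in U1. apply Ropp_lt_cancel, L in D1.
  apply Rabs_def1; nra.
Qed.

(** * Integrals with a parameter and continuity in two variables *)

Lemma is_derive_RInt_param_global (f df : R -> R -> R) (a b x : R) :
  locally x (fun y : R => forall s, is_derive (fun u => f u s) y (df y s)) ->
  (forall s, continuous (fun q : R * R => df (fst q) (snd q)) (x, s)) ->
  locally x (fun y : R => forall s, continuous (f y) s) ->
  is_derive (fun y => RInt (f y) a b) x (RInt (df x) a b).
Proof.
intros Hd Hc Hf.
evar_last.
- apply (is_derive_RInt_param f a b x).
  + revert Hd. apply filter_imp. intros y Hy s _. now exists (df y s).
  + intros s _. apply (continuity_2d_pt_ext_loc df).
    * destruct Hd as [e He]. exists e. intros u v Hu _.
      symmetry. apply is_derive_unique. now apply He.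
    * apply continuity_2d_pt_filterlim. apply Hc.
  + revert Hf. apply filter_imp. intros y Hy.
    apply (@ex_RInt_continuous R_CompleteNormedModule). auto.
- apply RInt_ext. intros s _. apply is_derive_unique.
  apply locally_singleton in Hd. apply Hd.
Qed.

Lemma continuous_continuity_pt (f : R -> R) x : continuous f x -> continuity_pt f x.
Proof. intros H. now apply continuity_pt_filterlim. Qed.

Lemma locally_gt0 b : 0 < b -> locally b (fun y : R => 0 < y).
Proof. intros Hb. exact (open_gt 0 b Hb). Qed.

Lemma continuity_2d_pt_fst (f : R -> R) x y :
  continuous f x -> continuity_2d_pt (fun u _ => f u) x y.
Proof.
intros H. apply continuity_1d_2d_pt_comp; [|apply continuity_2d_pt_id1].
now apply continuous_continuity_pt.
Qed.

Lemma continuity_2d_pt_snd (f : R -> R) x y :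
  continuous f y -> continuity_2d_pt (fun _ v => f v) x y.
Proof.
intros H. apply (continuity_1d_2d_pt_comp f (fun _ v => v)); [|apply continuity_2d_pt_id2].
now apply continuous_continuity_pt.
Qed.

Lemma continuity_2d_pt_pow (f : R -> R -> R) n x y :
  continuity_2d_pt f x y -> continuity_2d_pt (fun u v => f u v ^ n) x y.
Proof.
intros H. induction n as [|n IH]; simpl; [apply continuity_2d_pt_const|].
now apply continuity_2d_pt_mult.
Qed.

Lemma continuity_2d_pt_div (f g : R -> R -> R) x y :
  continuity_2d_pt f x y -> continuity_2d_pt g x y -> g x y <> 0 ->
  continuity_2d_pt (fun u v => f u v / g u v) x y.
Proof.
intros Hf Hg H0. apply continuity_2d_pt_mult; [exact Hf|].
now apply continuity_2d_pt_inv.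
Qed.

Lemma continuity_2d_pt_section (f : R -> R -> R) x y :
  continuity_2d_pt f x y -> continuous (f x) y.
Proof.
intros H. apply filterlim_locally. intros e.
destruct (H e) as [d Hd]. exists d. intros v Hv. apply Rabs_lt_ball, Hd; [|exact Hv].
rewrite Rminus_diag_eq, Rabs_R0; [apply cond_pos|reflexivity].
Qed.

Lemma continuous_exp_Rabs z : continuous (fun v => exp (Rabs v)) z.
Proof.
apply (continuous_comp Rabs exp); [apply continuous_Rabs|].
apply (ex_derive_continuous exp). auto_derive; auto.
Qed.

Lemma continuous_Rdiv (f g : R -> R) x :
  continuous f x -> continuous g x -> g x <> 0 -> continuous (fun y => f y / g y) x.
Proof.
intros Hf Hg H0. apply (continuous_mult f (fun y => / g y)); [exact Hf|].
now apply (continuous_Rinv_comp g).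
Qed.

Lemma locally_Rabs_eq (r : R) : 0 < r -> locally r (fun y : R => Rabs y = y).
Proof.
intros Hr. generalize (locally_gt0 r Hr). apply filter_imp.
intros y Hy. apply Rabs_pos_eq. now apply Rlt_le.
Qed.

Lemma continuous_abs_bounded (g : R -> R) a b :
  a <= b -> (forall t, a <= t <= b -> continuous g t) ->
  exists C, 0 <= C /\ forall t, a <= t <= b -> Rabs (g t) <= C.
Proof.
intros Hab Hg.
destruct (continuity_ab_maj (fun t => Rabs (g t)) a b Hab) as [x [Hx _]].
- intros c Hc. apply continuous_continuity_pt.
  apply (continuous_comp g Rabs); [now apply Hg|apply continuous_Rabs].
- exists (Rabs (g x)). split; [apply Rabs_pos|exact Hx].
Qed.

(** Uniform continuity along the compact segment bounds the difference of the integrands by a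
    constant. *)
Lemma continuous_RInt_param (h : R -> R -> R) a b t0 :
  a <= b -> (forall s, continuity_2d_pt h t0 s) ->
  locally t0 (fun t : R => forall s, continuous (h t) s) ->
  continuous (fun t => RInt (h t) a b) t0.
Proof.
intros Hab Hh Hc. apply filterlim_locally. intros e.
(* The summand 1 covers [a = b] and makes [(b - a) * (e / (b - a + 1)) < e] strict. *)
assert (He : 0 < e / (b - a + 1)).
{ apply Rdiv_lt_0_compat; [apply cond_pos|lra]. }
destruct (uniform_continuity_2d_1d' h a b t0 (fun s _ => Hh s) (mkposreal _ He)) as [d Hd].
simpl in Hd.
assert (Hi : forall t, (forall s, continuous (h t) s) -> ex_RInt (h t) a b).
{ intros t Ht. apply (@ex_RInt_continuous R_CompleteNormedModule). auto. }
assert (Hc0 := locally_singleton _ _ Hc).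
assert (Hloc : locally t0 (fun t : R => Rabs (t - t0) < d)).
{ exists d. intros y Hy. exact Hy. }
generalize (filter_and _ _ Hc Hloc). apply filter_imp. intros t [Ht1 Ht2].
apply Rabs_lt_ball.
replace (RInt (h t) a b - RInt (h t0) a b) with (RInt (fun s => h t s - h t0 s) a b).
2:{ apply (RInt_minus (h t) (h t0)); auto. }
apply Rle_lt_trans with ((b - a) * (e / (b - a + 1))).
- apply abs_RInt_le_const; [exact Hab| |].
  + apply (ex_RInt_minus (h t) (h t0)); auto.
  + intros s Hs. apply Rlt_le. apply Rabs_def2 in Ht2. apply Hd; try lra.
    rewrite Rminus_diag_eq, Rabs_R0; [apply cond_pos|reflexivity].
- pose proof (cond_pos e).
  apply (Rmult_lt_reg_r (b - a + 1)); [lra|].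
  replace ((b - a) * (e / (b - a + 1)) * (b - a + 1)) with ((b - a) * e) by (field; lra).
  nra.
Qed.

Lemma continuous_pair_swap (f : R * R -> R) x y :
  continuous f (y, x) -> continuous (fun q : R * R => f (snd q, fst q)) (x, y).
Proof.
intros Hf.
apply (continuous_comp_2 snd fst (fun a b : R => f (a, b))).
- apply continuous_snd.
- apply continuous_fst.
- apply (continuous_ext f); [|exact Hf]. now intros [a b].
Qed.

Lemma exists_small_before (J : R -> R) Tb e :
  (forall t, continuous J t) -> 0 < Tb -> J Tb = 0 -> 0 < e ->
  exists t, 0 < t < Tb /\ J t < e.
Proof.
intros Jc HTb HJ He.
assert (Hlt : J Tb < e) by lra.
destruct (Jc Tb _ (open_lt e _ Hlt)) as [d Hd].
pose proof (cond_pos d) as Hd0.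
exists (Rmax (Tb / 2) (Tb - d / 2)).
assert (Hm : 0 < Rmax (Tb / 2) (Tb - d / 2) < Tb /\ Tb - d / 2 <= Rmax (Tb / 2) (Tb - d / 2)).
{ unfold Rmax; destruct Rle_dec; lra. }
split; [tauto|]. apply Hd, Rabs_lt_ball. apply Rabs_def1; lra.
Qed.

(** * The trajectories and their Jacobian *)

Section Trajectories.

(** Here [b] labels a particle by its initial position, [U] stands for the initial velocity and [m]
    for the mass enclosed by the particle. *)
Context (k : R) (U dU m dm : R -> R) (k_gt0 : 0 < k)
  (U_gt0 : forall b, 0 < b -> 0 < U b) (m_ge0 : forall b, 0 < b -> 0 <= m b)
  (U_derive : forall b, 0 < b -> is_derive U b (dU b))
  (m_derive : forall b, 0 < b -> is_derive m b (dm b))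
  (dU_continuous : forall b, 0 < b -> continuous dU b)
  (dm_continuous : forall b, 0 < b -> continuous dm b).

(* With [Rabs z] in place of [z], which changes nothing for [t >= 0], [travel_time b] is an
   increasing C^1 bijection of R, so no one-sided derivatives arise at [t = 0]. *)
Definition speed b z := sqrt (U b ^ 2 + 2 * k * m b * Rabs z).
Definition time_density b z := b * exp (Rabs z) / speed b z.
(** The partial derivative of [time_density] in [b]; the factor [U b * dU b + k * dm b * Rabs z] is
    half the [b]-derivative of [speed ^ 2]. *)
Definition time_density_b b z :=
  exp (Rabs z) / speed b z
  - b * exp (Rabs z) * (U b * dU b + k * dm b * Rabs z) / speed b z ^ 3.
Definition travel_time b z := RInt (time_density b) 0 z.
Definition travel_time_b b z := RInt (time_density_b b) 0 z.

Lemma radicand_gt0 b z : 0 < b -> 0 < U b ^ 2 + 2 * k * m b * Rabs z.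
Proof.
intros Hb. assert (HU := U_gt0 b Hb). assert (Hm := m_ge0 b Hb).
assert (0 <= Rabs z) by apply Rabs_pos.
assert (0 <= k * m b * Rabs z) by (repeat apply Rmult_le_pos; lra).
assert (0 < U b ^ 2) by (apply pow_lt; lra). lra.
Qed.

Lemma speed_gt0 b z : 0 < b -> 0 < speed b z.
Proof. intros Hb. now apply sqrt_lt_R0, radicand_gt0. Qed.

Lemma speed_sqr b z : 0 < b -> speed b z ^ 2 = U b ^ 2 + 2 * k * m b * Rabs z.
Proof. intros Hb. apply pow2_sqrt. apply Rlt_le. now apply radicand_gt0. Qed.

Lemma time_density_gt0 b z : 0 < b -> 0 < time_density b z.
Proof.
intros Hb. apply Rdiv_lt_0_compat; [|now apply speed_gt0].
apply Rmult_lt_0_compat; [exact Hb|apply exp_pos].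
Qed.

Lemma U_continuous b : 0 < b -> continuous U b.
Proof. intros Hb. apply (ex_derive_continuous U). exists (dU b). auto. Qed.

Lemma m_continuous b : 0 < b -> continuous m b.
Proof. intros Hb. apply (ex_derive_continuous m). exists (dm b). auto. Qed.

Lemma continuity_2d_pt_speed b z : 0 < b -> continuity_2d_pt speed b z.
Proof.
intros Hb. unfold speed.
apply (continuity_1d_2d_pt_comp sqrt).
- apply continuity_pt_sqrt. apply Rlt_le. now apply radicand_gt0.
- apply continuity_2d_pt_plus.
  + apply continuity_2d_pt_pow, continuity_2d_pt_fst. now apply U_continuous.
  + apply continuity_2d_pt_mult; [apply continuity_2d_pt_mult|].
    * apply continuity_2d_pt_const.
    * apply continuity_2d_pt_fst. now apply m_continuous.
    * apply continuity_2d_pt_snd, continuous_Rabs.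
Qed.

Lemma continuity_2d_pt_time_density b z : 0 < b -> continuity_2d_pt time_density b z.
Proof.
intros Hb. apply continuity_2d_pt_div.
- apply continuity_2d_pt_mult; [apply continuity_2d_pt_id1|].
  apply (continuity_2d_pt_snd (fun v => exp (Rabs v))), continuous_exp_Rabs.
- now apply continuity_2d_pt_speed.
- apply Rgt_not_eq. now apply speed_gt0.
Qed.

Lemma continuity_2d_pt_time_density_b b z :
  0 < b -> continuity_2d_pt time_density_b b z.
Proof.
intros Hb.
assert (He := continuity_2d_pt_snd (fun v => exp (Rabs v)) b z (continuous_exp_Rabs z)).
assert (Hs := continuity_2d_pt_speed b z Hb).
assert (H0 := speed_gt0 b z Hb).
apply continuity_2d_pt_minus; apply continuity_2d_pt_div.
- exact He.
- exact Hs.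
- lra.
- apply continuity_2d_pt_mult; [apply continuity_2d_pt_mult|].
  + apply continuity_2d_pt_id1.
  + exact He.
  + apply continuity_2d_pt_plus; apply continuity_2d_pt_mult.
    * apply continuity_2d_pt_fst. now apply U_continuous.
    * apply continuity_2d_pt_fst. now apply dU_continuous.
    * apply (continuity_2d_pt_fst (fun u => k * dm u)).
      apply (continuous_mult (fun _ => k) dm); [apply continuous_const|auto].
    * apply continuity_2d_pt_snd, continuous_Rabs.
- now apply continuity_2d_pt_pow.
- apply pow_nonzero. lra.
Qed.

Lemma is_derive_time_density_b b z :
  0 < b -> is_derive (fun b => time_density b z) b (time_density_b b z).
Proof.
intros Hb. unfold time_density, time_density_b.
assert (H0 := speed_gt0 b z Hb). assert (H1 := radicand_gt0 b z Hb).
assert (HS : is_derive (fun b => speed b z) b ((U b * dU b + k * dm b * Rabs z) / speed b z)).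
{ unfold speed.
  evar_last.
  - apply (is_derive_comp sqrt (fun b => U b ^ 2 + 2 * k * m b * Rabs z)).
    + now apply is_derive_sqrt; [apply is_derive_id|].
    + apply (is_derive_plus (fun b => U b ^ 2) (fun b => 2 * k * m b * Rabs z)).
      * apply (is_derive_pow U 2). now apply U_derive.
      * apply (is_derive_ext (fun b => (2 * k * Rabs z) * m b)).
        { intros t. simpl. ring. }
        apply (is_derive_scal m). now apply m_derive.
  - unfold speed in H0. unfold plus, scal, one; simpl; unfold mult; simpl.
    field. simpl in H0. lra. }
evar_last.
- apply (is_derive_div (fun b => b * exp (Rabs z)) (fun b => speed b z)).
  + apply (is_derive_ext (fun b => exp (Rabs z) * b)); [intros; simpl; ring|].
    apply (is_derive_scal (fun b => b)). apply (is_derive_id b).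
  + exact HS.
  + lra.
- unfold one; simpl. field. lra.
Qed.

Lemma is_derive_travel_time b z :
  0 < b -> is_derive (travel_time b) z (time_density b z).
Proof.
intros Hb.
assert (Hc : forall s, continuous (time_density b) s).
{ intros s. apply continuity_2d_pt_section. now apply continuity_2d_pt_time_density. }
apply (is_derive_RInt (time_density b) (travel_time b) 0 z); [|apply Hc].
apply filter_forall. intros y. apply (@RInt_correct R_CompleteNormedModule).
apply (@ex_RInt_continuous R_CompleteNormedModule). auto.
Qed.

Lemma continuous_time_density_b b z : 0 < b -> continuous (time_density_b b) z.
Proof.
intros Hb. apply continuity_2d_pt_section. now apply continuity_2d_pt_time_density_b.
Qed.

Lemma is_derive_travel_time_b_z b z :
  0 < b -> is_derive (travel_time_b b) z (time_density_b b z).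
Proof.
intros Hb.
apply (is_derive_RInt (time_density_b b) (travel_time_b b) 0 z).
- apply filter_forall. intros y. apply (@RInt_correct R_CompleteNormedModule).
  apply (@ex_RInt_continuous R_CompleteNormedModule).
  intros; now apply continuous_time_density_b.
- now apply continuous_time_density_b.
Qed.

Lemma is_derive_travel_time_b b z :
  0 < b -> is_derive (fun b => travel_time b z) b (travel_time_b b z).
Proof.
intros Hb.
apply (is_derive_RInt_param_global time_density time_density_b 0 z b).
- generalize (locally_gt0 b Hb). apply filter_imp. intros y Hy s.
  now apply is_derive_time_density_b.
- intros s. apply continuity_2d_pt_filterlim. now apply continuity_2d_pt_time_density_b.
- generalize (locally_gt0 b Hb). apply filter_imp. intros y Hy s.
  apply continuity_2d_pt_section. now apply continuity_2d_pt_time_density.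
Qed.

Lemma travel_time_incr b x y : 0 < b -> x < y -> travel_time b x < travel_time b y.
Proof.
intros Hb Hxy.
destruct (MVT_cor2 (travel_time b) (time_density b) x y Hxy) as [c [Hc _]].
- intros c _. apply is_derive_Reals. now apply is_derive_travel_time.
- assert (0 < time_density b c) by now apply time_density_gt0. nra.
Qed.

Lemma travel_time_le b x y : 0 < b -> x <= y -> travel_time b x <= travel_time b y.
Proof.
intros Hb [H| ->]; [|lra]. apply Rlt_le. now apply travel_time_incr.
Qed.

Lemma travel_time_0 b : travel_time b 0 = 0.
Proof. apply (@RInt_point R_CompleteNormedModule). Qed.

(* Rests on [U^2 + 2 k m z <= (U^2 + 2 k m) (1 + z) <= (U^2 + 2 k m) e^(2 z)]
   for [z >= 0]. *)
Lemma time_density_ge b z : 0 < b -> b / sqrt (U b ^ 2 + 2 * k * m b) <= time_density b z.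
Proof.
intros Hb.
assert (HC : 0 < U b ^ 2 + 2 * k * m b).
(* The constant is the radicand of [speed] at [z = 1]. *)
{ replace (2 * k * m b) with (2 * k * m b * Rabs 1) by (rewrite Rabs_R1; ring).
  now apply radicand_gt0. }
set (C := U b ^ 2 + 2 * k * m b) in *.
assert (HsC : 0 < sqrt C) by now apply sqrt_lt_R0.
assert (Hs := speed_gt0 b z Hb).
assert (Hz : 0 <= Rabs z) by apply Rabs_pos.
assert (He : 1 + Rabs z <= exp (Rabs z)) by apply exp_ineq1_le.
assert (Hle : speed b z <= sqrt C * exp (Rabs z)).
{ assert (Hkm : 0 <= k * m b) by (apply Rmult_le_pos; [lra|auto]).
  assert (0 <= U b ^ 2) by apply pow2_ge_0.
  apply Rsqr_incr_0_var; [|apply Rmult_le_pos; lra].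
  unfold Rsqr. replace (speed b z * speed b z) with (speed b z ^ 2) by ring.
  rewrite speed_sqr by assumption.
  replace (sqrt C * exp (Rabs z) * (sqrt C * exp (Rabs z)))
    with (sqrt C * sqrt C * (exp (Rabs z) * exp (Rabs z))) by ring.
  rewrite sqrt_sqrt by lra.
  apply Rle_trans with (C * (1 + Rabs z)).
  - unfold C. nra.
  - apply Rmult_le_compat_l; nra. }
unfold time_density.
apply (Rmult_le_reg_r (sqrt C * speed b z)); [now apply Rmult_lt_0_compat|].
replace (b / sqrt C * (sqrt C * speed b z)) with (b * speed b z) by (field; lra).
replace (b * exp (Rabs z) / speed b z * (sqrt C * speed b z))
  with (b * (sqrt C * exp (Rabs z))) by (field; lra).
apply Rmult_le_compat_l; lra.
Qed.

(** The density is bounded below by a positive constant depending on [b] only, so the travel time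
    grows at least linearly in both directions. Physically, no particle escapes to infinity in
    finite time. *)
Lemma travel_time_surj b t : 0 < b -> exists z, travel_time b z = t.
Proof.
intros Hb.
assert (HC : 0 < U b ^ 2 + 2 * k * m b).
{ replace (2 * k * m b) with (2 * k * m b * Rabs 1) by (rewrite Rabs_R1; ring).
  now apply radicand_gt0. }
pose (c := b / sqrt (U b ^ 2 + 2 * k * m b)).
assert (Hc : 0 < c) by (apply Rdiv_lt_0_compat; [exact Hb|now apply sqrt_lt_R0]).
assert (Hlow : forall x y, x < y -> c * (y - x) <= travel_time b y - travel_time b x).
{ intros x y Hxy.
  destruct (MVT_cor2 (travel_time b) (time_density b) x y Hxy) as [d [Hd _]].
  - intros d _. apply is_derive_Reals. now apply is_derive_travel_time.
  - rewrite Hd. apply Rmult_le_compat_r; [lra|]. now apply time_density_ge. }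
(* Chosen so that linear growth with slope [c] carries the travel time beyond [Rabs t] at [r] and
   below [- Rabs t] at [- r]. *)
pose (r := (Rabs t + 1) / c).
assert (Hr : c * r = Rabs t + 1) by (unfold r; field; lra).
assert (Ht0 : 0 <= Rabs t) by apply Rabs_pos.
assert (Hr0 : 0 < r) by (apply Rdiv_lt_0_compat; lra).
pose proof (Hlow (- r) 0 ltac:(lra)) as H1.
pose proof (Hlow 0 r ltac:(lra)) as H2.
rewrite travel_time_0 in H1, H2.
assert (Ht : - Rabs t <= t <= Rabs t) by (unfold Rabs; destruct Rcase_abs; lra).
destruct (IVT_gen (travel_time b) (- r) r t) as [z [_ Hz]].
- intros z. apply continuous_continuity_pt.
  apply (ex_derive_continuous (travel_time b)). exists (time_density b z).
  now apply is_derive_travel_time.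
- rewrite Rmin_left, Rmax_right by lra. lra.
- now exists z.
Qed.

(** The inverse of [travel_time b], obtained by choice. For [0 < b] the preimage exists and strict
    monotonicity makes it unique; for other [b] the value is arbitrary. *)
Definition log_radius b t := epsilon (inhabits 0) (fun z => travel_time b z = t).

Lemma travel_time_log_radius b t : 0 < b -> travel_time b (log_radius b t) = t.
Proof.
intros Hb. exact (epsilon_spec (inhabits 0) _ (travel_time_surj b t Hb)).
Qed.

Lemma log_radius_0 b : 0 < b -> log_radius b 0 = 0.
Proof.
intros Hb. pose proof (travel_time_log_radius b 0 Hb) as H.
pose proof (travel_time_0 b) as H0.
destruct (Rtotal_order (log_radius b 0) 0) as [Hl|[He|Hg]]; [|exact He|].
- apply (travel_time_incr b) in Hl; lra.
- apply (travel_time_incr b) in Hg; lra.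
Qed.

Lemma log_radius_gt0 b t : 0 < b -> 0 < t -> 0 < log_radius b t.
Proof.
intros Hb Ht. apply Rnot_le_lt. intros Hl.
apply (travel_time_le b) in Hl; [|exact Hb].
rewrite travel_time_0, travel_time_log_radius in Hl by exact Hb. lra.
Qed.

Lemma log_radius_ge0 b t : 0 < b -> 0 <= t -> 0 <= log_radius b t.
Proof.
intros Hb [Ht| <-]; [apply Rlt_le; now apply log_radius_gt0|].
rewrite log_radius_0; lra.
Qed.

(** Implicit differentiation of [travel_time b z - t = 0] with [t] as the parameter; it holds on
    both sides of [t = 0] because [travel_time b] is C^1 on all of R. *)
Lemma is_derive_log_radius b t :
  0 < b -> is_derive (log_radius b) t (/ time_density b (log_radius b t)).
Proof.
intros Hb. assert (Hd := time_density_gt0 b (log_radius b t) Hb).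
evar_last.
- apply (is_derive_implicit (fun z t => travel_time b z - t)
           (fun z _ => time_density b z) (-1) 0).
  + apply filter_forall. intros q. simpl.
    evar_last.
    * apply (is_derive_minus (travel_time b) (fun _ => snd q)).
      -- now apply is_derive_travel_time.
      -- apply (is_derive_const (snd q)).
    * unfold minus, plus, opp, zero; simpl. ring.
  + auto_derive; auto; ring.
  + apply (continuous_comp fst (time_density b)); [apply continuous_fst|].
    apply continuity_2d_pt_section. now apply continuity_2d_pt_time_density.
  + exact Hd.
  + apply filter_forall. intros q. rewrite travel_time_log_radius by exact Hb.
    split; [ring|]. intros x y Hxy. apply (travel_time_le b) in Hxy; lra.
- simpl. field. lra.
Qed.

(** Implicit differentiation again, now with the label [b] as the parameter and [t] as the fixed
    level. *)
Lemma is_derive_log_radius_b b t :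
  0 < b -> is_derive (fun b => log_radius b t) b
    (- travel_time_b b (log_radius b t) / time_density b (log_radius b t)).
Proof.
intros Hb. assert (Hd := time_density_gt0 b (log_radius b t) Hb).
apply (is_derive_implicit (fun z b => travel_time b z) (fun z b => time_density b z)
         (travel_time_b b (log_radius b t)) t (fun b => log_radius b t) b).
- destruct (locally_gt0 b Hb) as [e He]. exists e. intros q [_ Hq].
  apply is_derive_travel_time. now apply He.
- now apply is_derive_travel_time_b.
- apply (continuous_comp_2 snd fst time_density).
  + apply continuous_snd.
  + apply continuous_fst.
  + apply continuity_2d_pt_filterlim. now apply continuity_2d_pt_time_density.
- exact Hd.
- generalize (locally_gt0 b Hb). apply filter_imp. intros y Hy.
  split; [now apply travel_time_log_radius|]. intros; now apply travel_time_le.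
Qed.

(** * Radius, velocity and Jacobian of a trajectory *)

Definition radius b t := b * exp (log_radius b t).
Definition velocity b t := speed b (log_radius b t).
(** For [t >= 0] this is the derivative of [radius] in [b]: writing [z] for the logarithmic radius,
    [exp z + b * exp z * dz/db] simplifies by [dz/db = - travel_time_b / time_density] and
    [time_density = b * exp z / velocity]. *)
Definition jacobian b t :=
  exp (log_radius b t) - travel_time_b b (log_radius b t) * velocity b t.
(* The derivative in [b] of [velocity ^ 2 = U b ^ 2 + 2 k m b * log_radius], divided by
   [2 * velocity]. *)
Definition jacobian_rate b t :=
  (U b * dU b + k * dm b * log_radius b t
   + k * m b * (jacobian b t / radius b t - 1 / b)) / velocity b t.

Lemma radius_gt0 b t : 0 < b -> 0 < radius b t.
Proof. intros Hb. apply Rmult_lt_0_compat; [exact Hb|apply exp_pos]. Qed.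

Lemma velocity_gt0 b t : 0 < b -> 0 < velocity b t.
Proof. intros Hb. now apply speed_gt0. Qed.

Lemma radius_0 b : 0 < b -> radius b 0 = b.
Proof. intros Hb. unfold radius. rewrite log_radius_0, exp_0 by exact Hb. ring. Qed.

Lemma velocity_0 b : 0 < b -> velocity b 0 = U b.
Proof.
intros Hb. unfold velocity, speed. rewrite log_radius_0, Rabs_R0 by exact Hb.
rewrite Rmult_0_r, Rplus_0_r. apply sqrt_pow2. apply Rlt_le. auto.
Qed.

Lemma jacobian_0 b : 0 < b -> jacobian b 0 = 1.
Proof.
intros Hb. unfold jacobian. rewrite log_radius_0, exp_0 by exact Hb.
unfold travel_time_b. rewrite (@RInt_point R_CompleteNormedModule).
unfold zero; simpl. ring.
Qed.

Lemma jacobian_rate_0 b : 0 < b -> jacobian_rate b 0 = dU b.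
Proof.
intros Hb. unfold jacobian_rate.
rewrite velocity_0, jacobian_0, radius_0, log_radius_0 by exact Hb.
assert (HU := U_gt0 b Hb). field. lra.
Qed.

Lemma continuous_log_radius b t : 0 < b -> continuous (log_radius b) t.
Proof.
intros Hb. apply (ex_derive_continuous (log_radius b)).
eexists. now apply is_derive_log_radius.
Qed.

Lemma continuous_radius b t : 0 < b -> continuous (radius b) t.
Proof.
intros Hb. apply (continuous_mult (fun _ => b)); [apply continuous_const|].
apply (continuous_comp (log_radius b) exp); [now apply continuous_log_radius|].
apply (ex_derive_continuous exp). auto_derive; auto.
Qed.

Lemma continuous_velocity b t : 0 < b -> continuous (velocity b) t.
Proof.
intros Hb. apply (continuous_comp (log_radius b) (speed b)).
- now apply continuous_log_radius.
- apply continuity_2d_pt_section. now apply continuity_2d_pt_speed.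
Qed.

Lemma continuous_jacobian b t : 0 < b -> continuous (jacobian b) t.
Proof.
intros Hb.
apply (continuous_minus (fun t => exp (log_radius b t))
         (fun t => travel_time_b b (log_radius b t) * velocity b t)).
- apply (continuous_comp (log_radius b) exp); [now apply continuous_log_radius|].
  apply (ex_derive_continuous exp). auto_derive; auto.
- apply (continuous_mult (fun t => travel_time_b b (log_radius b t)));
    [|now apply continuous_velocity].
  apply (continuous_comp (log_radius b) (travel_time_b b)).
  + now apply continuous_log_radius.
  + apply (ex_derive_continuous (travel_time_b b)).
    eexists. now apply is_derive_travel_time_b_z.
Qed.

Lemma continuous_jacobian_rate b t : 0 < b -> continuous (jacobian_rate b) t.
Proof.
intros Hb. assert (Hv := velocity_gt0 b t Hb). assert (Hr := radius_gt0 b t Hb).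
apply (continuous_Rdiv (fun t => U b * dU b + k * dm b * log_radius b t
   + k * m b * (jacobian b t / radius b t - 1 / b)) (velocity b));
  [|now apply continuous_velocity|lra].
apply (continuous_plus (fun t => U b * dU b + k * dm b * log_radius b t)
  (fun t => k * m b * (jacobian b t / radius b t - 1 / b))).
- apply (continuous_plus (fun _ => U b * dU b) (fun t => k * dm b * log_radius b t)).
  + apply continuous_const.
  + apply (continuous_mult (fun _ => k * dm b)); [apply continuous_const|].
    now apply continuous_log_radius.
- apply (continuous_mult (fun _ => k * m b)); [apply continuous_const|].
  apply (continuous_minus (fun t => jacobian b t / radius b t) (fun _ => 1 / b)).
  + apply (continuous_Rdiv (jacobian b) (radius b)).
    * now apply continuous_jacobian.
    * now apply continuous_radius.
    * lra.
  + apply continuous_const.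
Qed.

Lemma log_radius_derive b t :
  0 < b -> 0 <= t -> is_derive (log_radius b) t (velocity b t / radius b t).
Proof.
intros Hb Ht. evar_last; [now apply is_derive_log_radius|].
assert (Hv := velocity_gt0 b t Hb). assert (Hr := radius_gt0 b t Hb).
unfold time_density, radius in *. rewrite Rabs_pos_eq by now apply log_radius_ge0.
change (speed b (log_radius b t)) with (velocity b t).
assert (He := exp_pos (log_radius b t)). field. lra.
Qed.

Lemma radius_derive b t :
  0 < b -> 0 <= t -> is_derive (radius b) t (velocity b t).
Proof.
intros Hb Ht. assert (Hv := velocity_gt0 b t Hb). assert (Hr := radius_gt0 b t Hb).
evar_last.
- apply (is_derive_scal (fun t => exp (log_radius b t))).
  apply (is_derive_comp exp (log_radius b)); [apply is_derive_exp|].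
  now apply log_radius_derive.
- unfold scal; simpl; unfold mult; simpl. unfold radius in *.
  assert (He := exp_pos (log_radius b t)). field. lra.
Qed.

Lemma velocity_eq b t :
  0 < b -> 0 <= t -> velocity b t = sqrt (U b ^ 2 + 2 * k * m b * log_radius b t).
Proof.
intros Hb Ht. unfold velocity, speed. now rewrite Rabs_pos_eq by now apply log_radius_ge0.
Qed.

Lemma velocity_sqr b t :
  0 < b -> 0 <= t -> U b ^ 2 + 2 * k * m b * log_radius b t = velocity b t ^ 2.
Proof.
intros Hb Ht. unfold velocity. rewrite speed_sqr by exact Hb.
now rewrite Rabs_pos_eq by now apply log_radius_ge0.
Qed.

(** Differentiating the energy identity gives [2 v v' = 2 k m z'] with [z' = v / r]. The time is
    positive because the absolute value in [speed] has a kink at [z = 0]. *)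
Lemma velocity_derive b t :
  0 < b -> 0 < t -> is_derive (velocity b) t (k * (m b / radius b t)).
Proof.
intros Hb Ht. assert (Hv := velocity_gt0 b t Hb). assert (Hr := radius_gt0 b t Hb).
assert (Hsq := velocity_sqr b t Hb (Rlt_le _ _ Ht)).
apply (is_derive_ext_loc (fun t => sqrt (U b ^ 2 + 2 * k * m b * log_radius b t))).
- generalize (locally_gt0 t Ht). apply filter_imp. intros s Hs. symmetry.
  apply velocity_eq; [exact Hb|now apply Rlt_le].
- evar_last.
  + apply (is_derive_comp sqrt (fun t => U b ^ 2 + 2 * k * m b * log_radius b t)).
    * apply is_derive_sqrt; [apply is_derive_id|].
      rewrite Hsq. now apply pow_lt.
    * apply (is_derive_plus (fun _ => U b ^ 2) (fun t => 2 * k * m b * log_radius b t)).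
      -- apply (is_derive_const (U b ^ 2)).
      -- apply (is_derive_scal (log_radius b)). apply log_radius_derive; [exact Hb|lra].
  + rewrite Hsq, sqrt_pow2 by lra.
    unfold plus, scal, one, zero; simpl; unfold mult; simpl. field. lra.
Qed.

Lemma radius_derive_b b t :
  0 < b -> 0 <= t -> is_derive (fun b => radius b t) b (jacobian b t).
Proof.
intros Hb Ht. assert (Hv := velocity_gt0 b t Hb). assert (Hr := radius_gt0 b t Hb).
evar_last.
- apply (is_derive_mult (fun b => b) (fun b => exp (log_radius b t)));
    [apply (is_derive_id b)| |exact Rmult_comm].
  apply (is_derive_comp exp (fun b => log_radius b t)); [apply is_derive_exp|].
  now apply is_derive_log_radius_b.
- unfold plus, scal, mult, one; simpl; unfold mult; simpl.
  unfold jacobian, time_density, radius in *.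
  rewrite Rabs_pos_eq by now apply log_radius_ge0.
  change (speed b (log_radius b t)) with (velocity b t).
assert (He := exp_pos (log_radius b t)). field. lra.
Qed.

Lemma log_radius_derive_b b t :
  0 < b -> 0 <= t ->
  is_derive (fun b => log_radius b t) b (jacobian b t / radius b t - 1 / b).
Proof.
intros Hb Ht. assert (Hv := velocity_gt0 b t Hb). assert (Hr := radius_gt0 b t Hb).
evar_last; [now apply is_derive_log_radius_b|].
unfold jacobian, time_density, radius in *.
rewrite Rabs_pos_eq by now apply log_radius_ge0.
change (speed b (log_radius b t)) with (velocity b t).
assert (He := exp_pos (log_radius b t)). field. lra.
Qed.

Lemma velocity_derive_b b t :
  0 < b -> 0 <= t -> is_derive (fun b => velocity b t) b (jacobian_rate b t).
Proof.
intros Hb Ht. assert (Hv := velocity_gt0 b t Hb). assert (Hr := radius_gt0 b t Hb).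
assert (Hsq := velocity_sqr b t Hb Ht).
apply (is_derive_ext_loc (fun b => sqrt (U b ^ 2 + 2 * k * m b * log_radius b t))).
- generalize (locally_gt0 b Hb). apply filter_imp. intros s Hs. symmetry.
  now apply velocity_eq.
- evar_last.
  + apply (is_derive_comp sqrt (fun b => U b ^ 2 + 2 * k * m b * log_radius b t)).
    * apply is_derive_sqrt; [apply is_derive_id|].
      rewrite Hsq. now apply pow_lt.
    * apply (is_derive_plus (fun b => U b ^ 2) (fun b => 2 * k * m b * log_radius b t)).
      -- apply (is_derive_pow U 2). now apply U_derive.
      -- apply (is_derive_mult (fun b => 2 * k * m b) (fun b => log_radius b t));
           [| |exact Rmult_comm].
         ++ apply (is_derive_scal m). now apply m_derive.
         ++ now apply log_radius_derive_b.
  + rewrite Hsq, sqrt_pow2 by lra. unfold jacobian_rate.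
    unfold plus, scal, one, zero, mult; simpl; unfold mult; simpl. field. lra.
Qed.

(** Equality of the mixed derivatives of [radius], read off the explicit formulas. *)
Lemma jacobian_derive b t :
  0 < b -> 0 < t -> is_derive (jacobian b) t (jacobian_rate b t).
Proof.
intros Hb Ht. assert (Hv := velocity_gt0 b t Hb). assert (Hr := radius_gt0 b t Hb).
assert (HZ := log_radius_derive b t Hb (Rlt_le _ _ Ht)).
evar_last.
- apply (is_derive_minus (fun t => exp (log_radius b t))
         (fun t => travel_time_b b (log_radius b t) * velocity b t)).
  + apply (is_derive_comp exp (log_radius b)); [apply is_derive_exp|exact HZ].
  + apply (is_derive_mult (fun t => travel_time_b b (log_radius b t)) (velocity b));
      [| |exact Rmult_comm].
    * apply (is_derive_comp (travel_time_b b) (log_radius b)); [|exact HZ].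
      now apply is_derive_travel_time_b_z.
    * now apply velocity_derive.
- unfold minus, opp, plus, scal, mult; simpl; unfold mult; simpl.
  unfold jacobian_rate, jacobian, time_density_b, radius in *.
  rewrite Rabs_pos_eq by (apply log_radius_ge0; lra).
  change (speed b (log_radius b t)) with (velocity b t).
assert (He := exp_pos (log_radius b t)). field. lra.
Qed.

(** This is the linearization in the label [b] of the equation of motion [r'' = k m / r]. *)
Lemma jacobian_rate_derive b t :
  0 < b -> 0 < t ->
  is_derive (jacobian_rate b) t
    (k * dm b / radius b t - k * m b * jacobian b t / radius b t ^ 2).
Proof.
intros Hb Ht. assert (Hv := velocity_gt0 b t Hb). assert (Hr := radius_gt0 b t Hb).
assert (HZ := log_radius_derive b t Hb (Rlt_le _ _ Ht)).
evar_last.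
- apply (is_derive_div (fun t => U b * dU b + k * dm b * log_radius b t
   + k * m b * (jacobian b t / radius b t - 1 / b)) (velocity b)).
  + apply (is_derive_plus (fun t => U b * dU b + k * dm b * log_radius b t)
      (fun t => k * m b * (jacobian b t / radius b t - 1 / b))).
    * apply (is_derive_plus (fun _ => U b * dU b) (fun t => k * dm b * log_radius b t)).
      -- apply (is_derive_const (U b * dU b)).
      -- apply (is_derive_scal (log_radius b) t (k * dm b)). exact HZ.
    * apply (is_derive_scal (fun t => jacobian b t / radius b t - 1 / b)).
      apply (is_derive_minus (fun t => jacobian b t / radius b t) (fun _ => 1 / b)).
      -- apply (is_derive_div (jacobian b) (radius b)).
         ++ now apply jacobian_derive.
         ++ apply radius_derive; [exact Hb|lra].
         ++ lra.
      -- apply (is_derive_const (1 / b)).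
  + now apply velocity_derive.
  + lra.
- unfold minus, opp, plus, scal, zero, mult; simpl; unfold mult; simpl.
  unfold jacobian_rate. field. lra.
Qed.

End Trajectories.

(** * Vanishing of the Jacobian *)

(** By contradiction: if [J] stayed positive, then [a / r <= 1] and the sign of the [mu] term would
    give [W' <= k nu] for all time. Two integrations bound [J] by a quadratic, which the threshold
    makes nonpositive somewhere unless [W 0 = 0]. *)
Lemma exists_nonpos_of_threshold (J W r : R -> R) (k a nu mu : R) :
  0 < k -> 0 < a -> 0 <= nu -> 0 <= mu -> J 0 = 1 ->
  (forall t, continuous J t) -> (forall t, continuous W t) ->
  (forall t, 0 <= t -> a <= r t) ->
  (forall t, 0 < t -> is_derive J t (W t)) ->
  (forall t, 0 < t -> is_derive W t (k * (nu * a) / r t - k * mu * J t / r t ^ 2)) ->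
  W 0 <= - sqrt (2 * k * nu) -> (W 0 = 0 -> 0 < mu) ->
  exists t, 0 < t /\ J t <= 0.
Proof.
intros hk ha hnu hmu J0 Jc Wc hr HJ HW HD Hmu.
destruct (classic (exists t, 0 < t /\ J t <= 0)) as [|Hn]; [assumption|exfalso].
assert (Jpos : forall t, 0 < t -> 0 < J t).
{ intros t Ht. apply Rnot_le_lt. intros Hle. apply Hn. now exists t. }
assert (Hr2 : forall t, 0 < t -> 0 <= mu * J t / r t ^ 2).
{ intros t Ht. specialize (hr t (Rlt_le _ _ Ht)). specialize (Jpos t Ht).
  apply Rdiv_le_0_compat; [apply Rmult_le_pos; lra|apply pow_lt; lra]. }
assert (HWub : forall t, 0 < t -> W t <= W 0 + k * nu * t).
{ intros t Ht.
  enough (W t - k * nu * t <= W 0 - k * nu * 0) by lra.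
  apply (derive_nonpos_ge (fun t => W t - k * nu * t)
    (fun t => k * (nu * a) / r t - k * mu * J t / r t ^ 2 - k * nu) 0 t Ht).
  - apply (continuous_at_right (fun t => W t - k * nu * t)).
    apply (continuous_minus W (fun t => k * nu * t)); [apply Wc|].
    apply (ex_derive_continuous (fun t => k * nu * t)). auto_derive; auto.
  - intros s Hs. apply (is_derive_minus W (fun t => k * nu * t)); [apply HW; lra|].
    auto_derive; auto; ring.
  - intros s Hs. specialize (Hr2 s ltac:(lra)). specialize (hr s ltac:(lra)).
    replace (k * mu * J s / r s ^ 2) with (k * (mu * J s / r s ^ 2)) by (field; lra).
    replace (k * (nu * a) / r s) with (k * nu * (a / r s)) by (field; lra).
    assert (a / r s <= 1).
    { apply (Rmult_le_reg_r (r s)); [lra|]. field_simplify; lra. }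
    assert (0 <= k * nu) by (apply Rmult_le_pos; lra).
    assert (0 <= k * (mu * J s / r s ^ 2)) by (apply Rmult_le_pos; lra).
    nra. }
assert (HJub : forall t, 0 < t -> J t <= 1 + W 0 * t + k * nu * t ^ 2 / 2).
{ intros t Ht.
  enough (J t - (W 0 * t + k * nu * t ^ 2 / 2) <= J 0 - (W 0 * 0 + k * nu * 0 ^ 2 / 2)).
  { rewrite J0 in H. lra. }
  apply (derive_nonpos_ge (fun t => J t - (W 0 * t + k * nu * t ^ 2 / 2))
    (fun t => W t - (W 0 + k * nu * t)) 0 t Ht).
  - apply (continuous_at_right (fun t => J t - (W 0 * t + k * nu * t ^ 2 / 2))).
    apply (continuous_minus J (fun t => W 0 * t + k * nu * t ^ 2 / 2)); [apply Jc|].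
    apply (ex_derive_continuous (fun t => W 0 * t + k * nu * t ^ 2 / 2)). auto_derive; auto.
  - intros s Hs.
    apply (is_derive_minus J (fun t => W 0 * t + k * nu * t ^ 2 / 2)); [apply HJ; lra|].
    auto_derive; auto; simpl; field.
  - intros s Hs. specialize (HWub s ltac:(lra)). lra. }
assert (Hkn : 0 <= k * nu) by (apply Rmult_le_pos; lra).
assert (Hsq : sqrt (2 * k * nu) * sqrt (2 * k * nu) = 2 * (k * nu))
  by (rewrite sqrt_sqrt; lra).
assert (Hs0 := sqrt_pos (2 * k * nu)).
set (D := W 0) in *.
destruct (Req_dec D 0) as [HD0|HD0].
(* With zero initial slope the threshold forces [nu = 0], and [mu > 0] makes [W] strictly
   decreasing. *)
- specialize (Hmu HD0). assert (hn0 : k * nu = 0) by nra.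
  assert (HW' : forall t, 0 < t -> k * (nu * a) / r t - k * mu * J t / r t ^ 2 < 0).
  { intros t Ht. specialize (Jpos t Ht). specialize (hr t (Rlt_le _ _ Ht)).
    assert (0 < k * mu * J t / r t ^ 2).
    { apply Rdiv_lt_0_compat; [|apply pow_lt; lra].
      repeat apply Rmult_lt_0_compat; lra. }
    replace (k * (nu * a) / r t) with (k * nu * (a / r t)) by (field; lra).
    rewrite hn0. lra. }
  assert (Hdec : forall x y, 0 < x < y -> W y < W x).
  { intros x y Hxy.
    destruct (MVT_cor2 W (fun t => k * (nu * a) / r t - k * mu * J t / r t ^ 2) x y)
      as [c [Hc1 Hc2]]; [lra| |].
    - intros c Hc. apply is_derive_Reals, HW. lra.
    - specialize (HW' c ltac:(lra)). nra. }
  (* Strict decrease is known for positive times only, so it starts at 1/2, where [W <= 0], and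
     yields [W 1 < 0]. *)
  assert (H12 := HWub (1/2) ltac:(lra)). rewrite hn0, HD0 in H12.
  assert (H1 := Hdec (1/2) 1 ltac:(lra)).
  assert (HW1 : W 1 < 0) by lra.
  (* The tangent to [J] at time 1 reaches 0 at [t], and [J] lies below this tangent afterwards. *)
  pose (t := 1 - J 1 / W 1).
  assert (HJ1 := Jpos 1 ltac:(lra)).
  assert (Et : W 1 * (t - 1) = - J 1) by (unfold t; field; lra).
  assert (Ht : 1 < t) by nra.
  destruct (MVT_cor2 J W 1 t Ht) as [c [Hc1 Hc2]].
  { intros c Hc. apply is_derive_Reals, HJ. lra. }
  assert (HWc := Hdec 1 c ltac:(lra)).
  assert (HJt := Jpos t ltac:(lra)). nra.
- assert (HDneg : D < 0) by lra.
  assert (HD2 : 2 * (k * nu) <= D * D) by nra.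
  destruct (Rle_lt_or_eq_dec _ _ Hkn) as [Hpos|Hzero].
  (* The vertex of the quadratic, whose minimum [1 - D^2 / (2 k nu)] is nonpositive by the
     threshold. *)
  + pose (t := - D / (k * nu)).
    assert (Et : k * nu * t = - D)
      by (unfold t; clear - Hpos; set (c := k * nu) in *; clearbody c; field; lra).
    assert (Ht : 0 < t) by (clear - Et Hpos HDneg; nra).
    assert (Hub := HJub t Ht). assert (HJt := Jpos t Ht).
    replace (k * nu * t ^ 2 / 2) with (k * nu * t * t / 2) in Hub by field.
    rewrite Et in Hub.
    assert (2 * (k * nu) * (1 + D * t / 2) <= 0).
    { replace (2 * (k * nu) * (1 + D * t / 2)) with (2 * (k * nu) + D * (k * nu * t)) by field.
      rewrite Et. lra. }
    nra.
  (* The quadratic has degenerated to the line [1 + D t], which vanishes here. *)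
  + pose (t := - 1 / D).
    assert (Et : D * t = - 1) by (unfold t; field; lra).
    assert (Ht : 0 < t) by nra.
    assert (Hub := HJub t Ht). assert (HJt := Jpos t Ht).
    rewrite <- Hzero in Hub. lra.
Qed.

(* [J' = g J] gives [J = exp (int g)], which cannot vanish while [g] is bounded below. *)
Lemma log_derivative_unbounded (J W g : R -> R) Tb :
  (forall t, continuous J t) -> (forall t, 0 < t -> is_derive J t (W t)) ->
  0 < Tb -> J 0 = 1 -> (forall t, 0 <= t < Tb -> 0 < J t) -> J Tb = 0 ->
  (forall t, 0 < t < Tb -> J t * g t = W t) ->
  unbounded_before Tb g.
Proof.
intros Jc Jd HTb J0 Jpos JTb Hg M.
destruct (classic (exists t, 0 < t < Tb /\ M < Rabs (g t))) as [|Hn]; [assumption|exfalso].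
assert (HM : forall t, 0 < t < Tb -> - M <= g t).
{ intros t Ht. assert (Rabs (g t) <= M).
  { apply Rnot_lt_le. intros H. apply Hn. now exists t. }
  apply Rabs_le_between in H. lra. }
(* With this [c] one has [g + c >= 0], so [J t * exp (c * t)] is nondecreasing and stays at least
   1. *)
set (c := Rmax 0 M).
assert (Hc : 0 <= c /\ M <= c) by (unfold c, Rmax; destruct Rle_dec; lra).
(* Close enough to [Tb] the product [J t * exp (c * t)] is less than [exp (c * (t - Tb)) <= 1], the
   contradiction sought. *)
destruct (exists_small_before J Tb (exp (- c * Tb)) Jc HTb JTb (exp_pos _))
  as [t [Ht HJt]].
assert (H : J 0 * exp (c * 0) <= J t * exp (c * t)).
{ apply (derive_nonneg_le (fun t => J t * exp (c * t))
    (fun t => W t * exp (c * t) + J t * (c * exp (c * t))) 0 t).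
  - lra.
  - apply (continuous_at_right (fun t => J t * exp (c * t))).
    apply (continuous_mult J (fun t => exp (c * t))); [apply Jc|].
    apply (ex_derive_continuous (fun t => exp (c * t))). auto_derive; auto.
  - intros s Hs. evar_last.
    + apply (is_derive_mult J (fun t => exp (c * t))); [apply Jd; lra| |exact Rmult_comm].
      auto_derive; reflexivity.
    + unfold plus, mult; simpl. ring.
  - intros s Hs. rewrite <- Hg by lra.
    assert (HMs := HM s ltac:(lra)). assert (HJs := Jpos s ltac:(lra)).
    assert (He := exp_pos (c * s)).
    replace (J s * g s * exp (c * s) + J s * (c * exp (c * s)))
      with (J s * exp (c * s) * (g s + c)) by ring.
    apply Rmult_le_pos; [apply Rmult_le_pos|]; lra. }
rewrite J0, Rmult_0_r, exp_0, Rmult_1_r in H.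
assert (Hexp : exp (- c * Tb) * exp (c * t) <= 1).
{ rewrite <- exp_plus, <- exp_0.
  destruct (Rle_lt_or_eq_dec (- c * Tb + c * t) 0) as [Hl|He]; [nra| |].
  - apply Rlt_le. now apply exp_increasing.
  - rewrite He. lra. }
assert (He := exp_pos (c * t)). nra.
Qed.

(** * Smooth solutions along the trajectories *)

(* Even reflection in both variables turns the one-sided continuity at [r = 0] and [t = 0]
   into ordinary continuity. *)
Lemma continuous_on_strip_reflect T (f : R -> R -> R) (r t : R) :
  continuous_on_strip T f -> Rabs t < T ->
  continuous (fun q : R * R => f (Rabs (fst q)) (Rabs (snd q))) (r, t).
Proof.
intros Hf Ht P HP.
assert (Hs : strip T (Rabs r, Rabs t)).
{ unfold strip; simpl. split; [|split]; [apply Rabs_pos|apply Rabs_pos|exact Ht]. }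
destruct (Hf _ Hs P HP) as [e He]. simpl in He.
assert (Hopen : locally (r, t) (fun q : R * R => Rabs (snd q) < T)).
{ assert (Hc : continuous (fun q : R * R => Rabs (snd q)) (r, t)).
  { apply (continuous_comp snd Rabs); [apply continuous_snd|apply continuous_Rabs]. }
  exact (Hc _ (open_lt T _ Ht)). }
destruct Hopen as [d Hd].
assert (Hmin : 0 < Rmin e d) by (apply Rmin_pos; apply cond_pos).
exists (mkposreal _ Hmin). intros q [Hq1 Hq2].
simpl in Hq1, Hq2.
assert (Hball : forall x y c, ball x c y -> ball (Rabs x) c (Rabs y)).
{ intros x y c Hc. eapply Rle_lt_trans; [apply Rabs_triang_inv2|exact Hc]. }
apply (He (Rabs (fst q), Rabs (snd q))).
- split; simpl; apply Hball; (eapply ball_le; [apply Rmin_l|eassumption]).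
- unfold strip; simpl. split; [|split]; [apply Rabs_pos|apply Rabs_pos|].
  apply Hd. split; (eapply ball_le; [apply Rmin_r|eassumption]).
Qed.

Lemma continuous_on_half_line_reflect (f : R -> R) (r : R) :
  continuous_on_half_line f -> continuous (fun x => f (Rabs x)) r.
Proof.
intros Hf P HP. destruct (Hf (Rabs r) (Rabs_pos r) P HP) as [e He].
exists e. intros y Hy. apply He; [|apply Rabs_pos].
eapply Rle_lt_trans; [apply Rabs_triang_inv2|exact Hy].
Qed.

Lemma continuous_on_half_line_pos (f : R -> R) (r : R) :
  continuous_on_half_line f -> 0 < r -> continuous f r.
Proof.
intros Hf Hr. apply (continuous_ext_loc f (fun x => f (Rabs x))).
- generalize (locally_Rabs_eq r Hr). apply filter_imp. now intros y ->.
- now apply continuous_on_half_line_reflect.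
Qed.

Section SmoothSolution.

Context (k T : R) (n0 u0 : R -> R) (n u phi nr nt ur ut : R -> R -> R)
  (n_continuous : continuous_on_strip T n) (u_continuous : continuous_on_strip T u)
  (nt_continuous : continuous_on_strip T nt)
  (ur_continuous : continuous_on_strip T ur)
  (n_derive : forall r t, 0 < r -> 0 < t < T ->
     is_derive (fun x => n x t) r (nr r t) /\ is_derive (fun s => n r s) t (nt r t))
  (u_derive : forall r t, 0 < r -> 0 < t < T ->
     is_derive (fun x => u x t) r (ur r t) /\ is_derive (fun s => u r s) t (ut r t))
  (initial : forall r, 0 <= r -> n r 0 = n0 r /\ u r 0 = u0 r)
  (equations : forall r t, 0 < r -> 0 < t < T ->
     r * Derive (fun s => n r s) t + Derive (fun x => n x t * u x t * x) r = 0 /\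
     Derive (fun s => u r s) t + u r t * Derive (fun x => u x t) r
       = - k * Derive (fun x => phi x t) r /\
     - Derive (fun x => phi x t) r * r = RInt (fun xi => n xi t * xi) 0 r).

(** Reflected values make the integrand continuous in [s] on the whole line for [Rabs t < T]. Time
    comes first because it is the parameter of the integral. *)
Definition mass_density (t s : R) := n (Rabs s) (Rabs t) * s.
Definition mass r t := RInt (mass_density t) 0 r.

Lemma mass_eq r t : 0 <= r -> 0 <= t -> mass r t = RInt (fun xi => n xi t * xi) 0 r.
Proof.
intros Hr Ht. apply RInt_ext. intros s Hs.
rewrite Rmin_left in Hs by lra. unfold mass_density.
now rewrite !Rabs_pos_eq by lra.
Qed.

Lemma continuous_strip_density (f : R -> R -> R) t s :
  continuous_on_strip T f -> Rabs t < T ->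
  continuous (fun q : R * R => f (Rabs (snd q)) (Rabs (fst q)) * snd q) (t, s).
Proof.
intros Hf Ht.
apply (continuous_mult (fun q : R * R => f (Rabs (snd q)) (Rabs (fst q))) snd).
- apply (continuous_pair_swap (fun q => f (Rabs (fst q)) (Rabs (snd q)))).
  now apply (continuous_on_strip_reflect T).
- apply continuous_snd.
Qed.

Lemma continuous_mass_density t s : Rabs t < T -> continuous (mass_density t) s.
Proof.
intros Ht. apply continuity_2d_pt_section. apply continuity_2d_pt_filterlim.
now apply (continuous_strip_density n).
Qed.

Lemma ex_RInt_mass_density t a b : Rabs t < T -> ex_RInt (mass_density t) a b.
Proof.
intros Ht. apply (@ex_RInt_continuous R_CompleteNormedModule).
intros; now apply continuous_mass_density.
Qed.

Lemma mass_derive_r r t : Rabs t < T -> is_derive (fun r => mass r t) r (mass_density t r).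
Proof.
intros Ht.
apply (is_derive_RInt (mass_density t) (fun r => mass r t) 0 r).
- apply filter_forall. intros y. apply (@RInt_correct R_CompleteNormedModule).
  now apply ex_RInt_mass_density.
- now apply continuous_mass_density.
Qed.

Lemma locally_between t : 0 < t < T -> locally t (fun s : R => 0 < s < T).
Proof.
intros Ht. apply (filter_and (fun s : R => 0 < s) (fun s : R => s < T)).
- now apply locally_gt0.
- exact (open_lt T t (proj2 Ht)).
Qed.

Lemma mass_derive_t_int r t : 0 < t < T ->
  is_derive (fun t => mass r t) t (RInt (fun s => nt (Rabs s) (Rabs t) * s) 0 r).
Proof.
intros Ht.
apply (is_derive_RInt_param_global mass_density (fun t s => nt (Rabs s) (Rabs t) * s)).
- generalize (locally_between t Ht). apply filter_imp. intros y Hy s.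
  unfold mass_density. rewrite (Rabs_pos_eq y) by lra.
  apply (is_derive_ext_loc (fun t => s * n (Rabs s) t)).
  + generalize (locally_Rabs_eq y (proj1 Hy)). apply filter_imp.
    intros x Hx. rewrite Hx. apply Rmult_comm.
  + rewrite Rmult_comm.
    (* At [s = 0] the time derivative of [n] is not given, but the factor [s] makes the integrand
       vanish identically there. *)
    destruct (Req_dec s 0) as [->|Hs].
    * rewrite Rmult_0_l. apply (is_derive_ext (fun _ => 0)).
      -- intros x. now rewrite Rmult_0_l.
      -- apply (is_derive_const 0).
    * apply (is_derive_scal (n (Rabs s))). apply n_derive; [now apply Rabs_pos_lt|exact Hy].
- intros s. apply (continuous_strip_density nt); [assumption|]. rewrite Rabs_pos_eq; lra.
- generalize (locally_between t Ht). apply filter_imp. intros y Hy s.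
  apply continuous_mass_density. rewrite Rabs_pos_eq; lra.
Qed.

(** The equation is stated with the total operator [Derive]; differentiability of the factors turns
    its value into a genuine derivative of the flux. *)
Lemma flux_derive r t : 0 < r -> 0 < t < T ->
  is_derive (fun x => n x t * u x t * x) r (- (nt r t * r)).
Proof.
intros Hr Ht.
destruct (n_derive r t Hr Ht) as [Hn1 Hn2]. destruct (u_derive r t Hr Ht) as [Hu1 Hu2].
destruct (equations r t Hr Ht) as [Heq _].
assert (E : Derive (fun s => n r s) t = nt r t) by now apply is_derive_unique.
rewrite E in Heq.
replace (- (nt r t * r)) with (Derive (fun x => n x t * u x t * x) r) by lra.
apply Derive_correct.
apply (ex_derive_mult (fun x => n x t * u x t) (fun x => x)).
- apply (ex_derive_mult (fun x => n x t) (fun x => u x t)); eexists; eassumption.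
- apply ex_derive_id.
Qed.

(** The sum [Q] of the flux and the integral has zero derivative for positive radii, is continuous
    up to the axis, and vanishes there because the flux carries the factor [r]. *)
Lemma flux_eq r t : 0 < r -> 0 < t < T ->
  RInt (fun s => nt (Rabs s) (Rabs t) * s) 0 r = - (n r t * u r t * r).
Proof.
intros Hr Ht.
assert (HtT : Rabs t < T) by (rewrite Rabs_pos_eq; lra).
pose (h := fun s => nt (Rabs s) (Rabs t) * s).
assert (Hh : forall s, continuous h s).
{ intros s. apply (continuity_2d_pt_section (fun t s => nt (Rabs s) (Rabs t) * s)).
  apply continuity_2d_pt_filterlim. now apply (continuous_strip_density nt). }
assert (HI : forall s, is_derive (fun r => RInt h 0 r) s (h s)).
{ intros s. apply (is_derive_RInt h (fun r => RInt h 0 r) 0 s); [|apply Hh].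
  apply filter_forall. intros y. apply (@RInt_correct R_CompleteNormedModule).
  apply (@ex_RInt_continuous R_CompleteNormedModule). auto. }
pose (Q := fun r => n (Rabs r) t * u (Rabs r) t * r + RInt h 0 r).
assert (Hstrip : forall f x, continuous_on_strip T f -> continuous (fun x => f (Rabs x) t) x).
{ intros f x Hf.
  apply (continuous_ext (fun x => f (Rabs x) (Rabs t))).
  { intros y. now rewrite (Rabs_pos_eq t) by lra. }
  apply (continuous_comp_2 (fun x => x) (fun _ => t) (fun a b => f (Rabs a) (Rabs b))).
  - apply continuous_id.
  - apply continuous_const.
  - now apply (continuous_on_strip_reflect T). }
assert (HQ0 : filterlim Q (at_right 0) (locally (Q 0))).
{ apply continuous_at_right.
  apply (continuous_plus (fun r => n (Rabs r) t * u (Rabs r) t * r) (fun r => RInt h 0 r)).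
  - apply (continuous_mult (fun r => n (Rabs r) t * u (Rabs r) t) (fun r => r)).
    + apply (continuous_mult (fun r => n (Rabs r) t) (fun r => u (Rabs r) t)); auto.
    + apply continuous_id.
  - apply (ex_derive_continuous (fun r => RInt h 0 r)). eexists. apply HI. }
assert (HQ : forall x, 0 < x <= r -> is_derive Q x 0).
{ intros x Hx.
  evar_last.
  - apply (is_derive_plus (fun r => n (Rabs r) t * u (Rabs r) t * r) (fun r => RInt h 0 r)).
    + apply (is_derive_ext_loc (fun x => n x t * u x t * x)).
      * generalize (locally_Rabs_eq x (proj1 Hx)). apply filter_imp. intros y Hy.
        now rewrite Hy.
      * apply flux_derive; [lra|exact Ht].
    + apply HI.
  - unfold h, plus; simpl. rewrite (Rabs_pos_eq x), (Rabs_pos_eq t) by lra. ring. }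
assert (H1 : Q 0 <= Q r).
{ apply (derive_nonneg_le Q (fun _ => 0) 0 r Hr HQ0 HQ). intros; lra. }
assert (H2 : Q r <= Q 0).
{ apply (derive_nonpos_ge Q (fun _ => 0) 0 r Hr HQ0 HQ). intros; lra. }
assert (HQz : Q 0 = 0).
{ unfold Q. rewrite (@RInt_point R_CompleteNormedModule). unfold zero; simpl. ring. }
assert (HQr : Q r = n r t * u r t * r + RInt h 0 r).
{ unfold Q. now rewrite Rabs_pos_eq by lra. }
unfold h in HQr. lra.
Qed.

Lemma mass_derive_t r t : 0 < r -> 0 < t < T ->
  is_derive (fun t => mass r t) t (- (n r t * u r t * r)).
Proof.
intros Hr Ht. rewrite <- flux_eq by assumption. now apply mass_derive_t_int.
Qed.

(** The condition on [E r] at the axis turns the force [- k phi_r] into [k] times the enclosed mass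
    over [r]. *)
Lemma momentum r t : 0 < r -> 0 < t < T ->
  ut r t = - u r t * ur r t + k * (mass r t / r).
Proof.
intros Hr Ht. destruct (u_derive r t Hr Ht) as [Hu1 Hu2].
destruct (equations r t Hr Ht) as [_ [Heq Hphi]].
assert (E1 : Derive (fun s => u r s) t = ut r t) by now apply is_derive_unique.
assert (E2 : Derive (fun x => u x t) r = ur r t) by now apply is_derive_unique.
rewrite E1, E2 in Heq.
rewrite mass_eq by lra. rewrite <- Hphi.
field_simplify; lra.
Qed.

(* The substitution [xi = r * s] turns the mass into an integral over [0, 1]. *)
Lemma continuous_mass_along (r : R -> R) t :
  Rabs t < T -> (forall t, continuous r t) -> continuous (fun t => mass (r t) t) t.
Proof.
intros Ht Hr.
assert (Hloc : locally t (fun s : R => Rabs s < T)).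
{ exact (continuous_Rabs t _ (open_lt T _ Ht)). }
apply (continuous_ext_loc _ (fun t => RInt (fun s => r t * mass_density t (r t * s + 0)) 0 1)).
{ revert Hloc. apply filter_imp. intros s Hs. unfold mass.
  pose proof (RInt_comp_lin (mass_density s) (r s) 0 0 1) as H.
  rewrite Rmult_0_r, Rmult_1_r, !Rplus_0_r in H.
  apply H. now apply ex_RInt_mass_density. }
assert (Hjoint : forall t s, Rabs t < T ->
  continuity_2d_pt (fun t s => r t * mass_density t (r t * s + 0)) t s).
{ intros t' s Ht'. apply continuity_2d_pt_mult.
  - apply (continuity_2d_pt_fst r). apply Hr.
  - apply continuity_2d_pt_filterlim.
    apply (continuous_comp_2 fst (fun q : R * R => r (fst q) * snd q + 0) mass_density).
    + apply continuous_fst.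
    + apply (continuity_2d_pt_filterlim (fun t s => r t * s + 0)).
      apply continuity_2d_pt_plus; [|apply continuity_2d_pt_const].
      apply continuity_2d_pt_mult; [apply (continuity_2d_pt_fst r), Hr|].
      apply continuity_2d_pt_id2.
    + now apply (continuous_strip_density n). }
apply (continuous_RInt_param (fun t s => r t * mass_density t (r t * s + 0)) 0 1 t).
- lra.
- intros s. now apply Hjoint.
- revert Hloc. apply filter_imp. intros y Hy s.
  apply (continuity_2d_pt_section (fun t s => r t * mass_density t (r t * s + 0))).
  now apply Hjoint.
Qed.

Lemma continuous_strip_along (f : R -> R -> R) (r : R -> R) t :
  continuous_on_strip T f -> (forall t, continuous r t) -> Rabs t < T ->
  continuous (fun t => f (Rabs (r t)) (Rabs t)) t.
Proof.
intros Hf Hr Ht.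
apply (continuous_comp_2 r (fun t => t) (fun a b => f (Rabs a) (Rabs b))).
- apply Hr.
- apply continuous_id.
- now apply (continuous_on_strip_reflect T).
Qed.

Lemma locally_interior r t : 0 < r -> 0 < t < T ->
  locally (r, t) (fun q : R * R => 0 < fst q /\ 0 < snd q < T).
Proof.
intros Hr Ht.
destruct (locally_gt0 r Hr) as [d1 Hd1]. destruct (locally_between t Ht) as [d2 Hd2].
assert (Hmin : 0 < Rmin d1 d2) by (apply Rmin_pos; apply cond_pos).
exists (mkposreal _ Hmin). intros q [Hq1 Hq2]. split.
- apply Hd1. eapply ball_le; [apply Rmin_l|exact Hq1].
- apply Hd2. eapply ball_le; [apply Rmin_r|exact Hq2].
Qed.

Lemma continuous_strip_interior (f : R -> R -> R) r t :
  continuous_on_strip T f -> 0 < r -> 0 < t < T ->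
  continuous (fun q : R * R => f (fst q) (snd q)) (r, t).
Proof.
intros Hf Hr Ht.
apply (continuous_ext_loc _ (fun q : R * R => f (Rabs (fst q)) (Rabs (snd q)))).
- generalize (locally_interior r t Hr Ht). apply filter_imp. intros [x y] [Hx Hy].
  simpl in *. now rewrite !Rabs_pos_eq by lra.
- apply (continuous_on_strip_reflect T); [exact Hf|]. rewrite Rabs_pos_eq; lra.
Qed.

(** The partial derivatives [n r] in radius and [- n u r] in time combine. The curve need not be a
    particle path, and the rate is proportional to its velocity defect. *)
Lemma mass_along_derive (r : R -> R) v t :
  0 < t < T -> 0 < r t -> is_derive r t v ->
  is_derive (fun t => mass (r t) t) t (n (r t) t * r t * (v - u (r t) t)).
Proof.
intros Ht Hrt Hr.
evar_last.
- apply (is_derive_comp_2 mass (fun r t => mass_density t r) (- (n (r t) t * u (r t) t * r t))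
           r (fun t => t) t v 1).
  + generalize (locally_interior (r t) t Hrt Ht). apply filter_imp. intros [x y] [Hx Hy].
    simpl in *. apply (mass_derive_r x y). rewrite Rabs_pos_eq; lra.
  + now apply mass_derive_t.
  + apply (continuous_pair_swap (fun q => mass_density (fst q) (snd q))).
    apply (continuous_strip_density n); [assumption|]. rewrite Rabs_pos_eq; lra.
  + exact Hr.
  + apply (is_derive_id t).
- unfold mass_density. rewrite !Rabs_pos_eq by lra. ring.
Qed.

Lemma velocity_along_derive (r : R -> R) v t :
  0 < t < T -> 0 < r t -> is_derive r t v ->
  is_derive (fun t => u (r t) t) t
    (ur (r t) t * (v - u (r t) t) + k * (mass (r t) t / r t)).
Proof.
intros Ht Hrt Hr.
evar_last.
- apply (is_derive_comp_2 u ur (ut (r t) t) r (fun t => t) t v 1).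
  + generalize (locally_interior (r t) t Hrt Ht). apply filter_imp. intros q [Hq1 Hq2].
    now apply u_derive.
  + now apply u_derive.
  + now apply continuous_strip_interior.
  + exact Hr.
  + apply (is_derive_id t).
- rewrite momentum by assumption. field. lra.
Qed.

(* The velocity defect [u - v] and the mass defect solve a homogeneous linear system
   along the curve [r], and both vanish initially. *)
Lemma solution_along_trajectory (r v : R -> R) (M : R) :
  0 < T -> (forall t, continuous r t) -> (forall t, continuous v t) ->
  (forall t, 0 <= t -> 0 < r t) ->
  v 0 = u0 (r 0) -> M = RInt (fun xi => n0 xi * xi) 0 (r 0) ->
  (forall t, 0 < t -> is_derive r t (v t)) ->
  (forall t, 0 < t -> is_derive v t (k * (M / r t))) ->
  forall t, 0 < t < T -> u (r t) t = v t /\ mass (r t) t = M.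
Proof.
intros HT Hr Hv Hpos Hv0 HM Hrd Hvd t1 Ht1.
assert (HabsT : forall t, 0 <= t <= t1 -> Rabs t < T) by (intros; rewrite Rabs_pos_eq; lra).
destruct (continuous_abs_bounded (fun t => ur (Rabs (r t)) (Rabs t)) 0 t1 ltac:(lra))
  as [A [HA0 HA]].
{ intros t Ht. apply continuous_strip_along; auto. }
destruct (continuous_abs_bounded (fun t => n (Rabs (r t)) (Rabs t) * r t) 0 t1 ltac:(lra))
  as [B [HB0 HB]].
{ intros t Ht. apply (continuous_mult (fun t => n (Rabs (r t)) (Rabs t)) r); [|auto].
  apply continuous_strip_along; auto. }
destruct (continuous_abs_bounded (fun t => k / r t) 0 t1 ltac:(lra)) as [C [HC0 HC]].
{ intros t Ht. apply (continuous_Rdiv (fun _ => k) r); [apply continuous_const|auto|].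
  apply Rgt_not_eq. apply Hpos. lra. }
(* The absolute values make [w] continuous at [t = 0] from both sides and change nothing for
   [t >= 0]. *)
pose (w := fun t => u (Rabs (r t)) (Rabs t) - v t).
pose (g := fun t => mass (r t) t - M).
assert (Hw0 : w 0 = 0).
{ unfold w. rewrite Rabs_R0, Rabs_pos_eq by (apply Rlt_le, Hpos; lra).
  rewrite (proj2 (initial (r 0) (Rlt_le _ _ (Hpos 0 (Rle_refl 0))))). lra. }
assert (Hg0 : g 0 = 0).
{ unfold g. assert (H0 := Hpos 0 (Rle_refl 0)). rewrite mass_eq by lra.
  rewrite HM. apply Rminus_diag_eq. apply RInt_ext. intros x Hx.
  rewrite Rmin_left in Hx by lra. now rewrite (proj1 (initial x ltac:(lra))). }
assert (Hwc : continuous w 0).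
{ apply (continuous_minus (fun t => u (Rabs (r t)) (Rabs t)) v); [|auto].
  apply continuous_strip_along; auto. rewrite Rabs_R0. exact HT. }
assert (Hgc : continuous g 0).
{ apply (continuous_minus (fun t => mass (r t) t) (fun _ => M)); [|apply continuous_const].
  apply continuous_mass_along; [|exact Hr]. rewrite Rabs_R0. exact HT. }
assert (Hwd : forall t, 0 < t <= t1 ->
  is_derive w t (- ur (r t) t * w t + k / r t * g t)).
{ intros t Ht. assert (Hrt := Hpos t ltac:(lra)).
  apply (is_derive_ext_loc (fun t => u (r t) t - v t)).
  - assert (Hl : locally t (fun s : R => 0 < r s)) by exact (Hr t _ (open_gt 0 _ Hrt)).
    generalize (filter_and _ _ Hl (locally_gt0 t (proj1 Ht))). apply filter_imp.
    intros s [Hs1 Hs2]. unfold w. now rewrite !Rabs_pos_eq by lra.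
  - evar_last.
    + apply (is_derive_minus (fun t => u (r t) t) v); [|apply Hvd; lra].
      apply (velocity_along_derive r (v t)); [lra|exact Hrt|apply Hrd; lra].
    + unfold w, g, minus, plus, opp; simpl. rewrite !Rabs_pos_eq by lra. field. lra. }
assert (Hgd : forall t, 0 < t <= t1 -> is_derive g t (- (n (r t) t * r t) * w t)).
{ intros t Ht. assert (Hrt := Hpos t ltac:(lra)).
  evar_last.
  - apply (is_derive_minus (fun t => mass (r t) t) (fun _ => M)).
    + apply (mass_along_derive r (v t)); [lra|exact Hrt|apply Hrd; lra].
    + apply (is_derive_const M).
  - unfold w, minus, plus, opp, zero; simpl. rewrite !Rabs_pos_eq by lra. ring. }
assert (HF : w t1 * w t1 + g t1 * g t1 <= 0).
{ apply (gronwall_zero (fun t => w t * w t + g t * g t)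
    (fun t => 2 * w t * (- ur (r t) t * w t + k / r t * g t)
              + 2 * g t * (- (n (r t) t * r t) * w t))
    (* The diagonal term contributes [2 * A]; the two cross terms contribute [C] and [B] through
       [2 |x y| <= x^2 + y^2]. *)
    (2 * A + C + B) t1).
  - lra.
  - apply (continuous_at_right (fun t => w t * w t + g t * g t)).
    apply (continuous_plus (fun t => w t * w t) (fun t => g t * g t)).
    + now apply (continuous_mult w w).
    + now apply (continuous_mult g g).
  - rewrite Hw0, Hg0. ring.
  - intros t Ht. specialize (Hwd t Ht). specialize (Hgd t Ht).
    evar_last.
    + apply (is_derive_plus (fun t => w t * w t) (fun t => g t * g t)).
      * apply (is_derive_mult w w); [exact Hwd|exact Hwd|exact Rmult_comm].
      * apply (is_derive_mult g g); [exact Hgd|exact Hgd|exact Rmult_comm].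
    + unfold plus, mult; simpl. ring.
  - intros t Ht. assert (Hrt := Hpos t ltac:(lra)).
    specialize (HA t ltac:(lra)). specialize (HB t ltac:(lra)). specialize (HC t ltac:(lra)).
    simpl in HA, HB, HC. rewrite !(Rabs_pos_eq (r t)), (Rabs_pos_eq t) in HA, HB by lra.
    apply Rabs_le_between in HA. apply Rabs_le_between in HB. apply Rabs_le_between in HC.
    set (a := ur (r t) t) in *. set (b := n (r t) t * r t) in *. set (c := k / r t) in *.
    set (x := w t). set (y := g t).
    clearbody a b c x y. clear - HA HB HC HA0.
    assert (Hx := Rle_0_sqr x). assert (Hy := Rle_0_sqr y). unfold Rsqr in Hx, Hy.
    assert (E1 : - 2 * a * (x * x) <= 2 * A * (x * x)) by nra.
    assert (E2 : 2 * c * (x * y) <= C * (x * x + y * y)).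
    (* The two nonnegative products add up to [2 C (x^2 + y^2) - 4 c x y]. *)
    { assert (0 <= (C - c) * ((x + y) * (x + y)))
        by (apply Rmult_le_pos; [lra|exact (Rle_0_sqr (x + y))]).
      assert (0 <= (C + c) * ((x - y) * (x - y)))
        by (apply Rmult_le_pos; [lra|exact (Rle_0_sqr (x - y))]). nra. }
    assert (E3 : - 2 * b * (x * y) <= B * (x * x + y * y)).
    { assert (0 <= (B + b) * ((x + y) * (x + y)))
        by (apply Rmult_le_pos; [lra|exact (Rle_0_sqr (x + y))]).
      assert (0 <= (B - b) * ((x - y) * (x - y)))
        by (apply Rmult_le_pos; [lra|exact (Rle_0_sqr (x - y))]). nra. }
    assert (0 <= 2 * A * (y * y)) by (apply Rmult_le_pos; lra).
    lra. }
assert (Hrt := Hpos t1 ltac:(lra)).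
assert (Hwz : w t1 = 0) by nra. assert (Hgz : g t1 = 0) by nra.
unfold w in Hwz. unfold g in Hgz. rewrite !Rabs_pos_eq in Hwz by lra. split; lra.
Qed.

End SmoothSolution.

(** Collects what the breakdown argument takes from a smooth solution: [u_r] is continuous up to the
    axis and to time 0, the enclosed mass has radial derivative [n r], and velocity and mass are
    prescribed along the trajectories. *)
Lemma smooth_solution_spec k n0 u0 T n u phi :
  smooth_solution k n0 u0 T n u phi ->
  exists ur : R -> R -> R,
    continuous_on_strip T ur /\
    (forall r t, 0 < r -> 0 < t < T -> is_derive (fun x => u x t) r (ur r t)) /\
    (forall r t, 0 < r -> 0 < t < T ->
       is_derive (fun x => RInt (fun xi => n xi t * xi) 0 x) r (n r t * r)) /\
    (forall (r v : R -> R) (M : R),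
       (forall t, continuous r t) -> (forall t, continuous v t) ->
       (forall t, 0 <= t -> 0 < r t) ->
       v 0 = u0 (r 0) -> M = RInt (fun xi => n0 xi * xi) 0 (r 0) ->
       (forall t, 0 < t -> is_derive r t (v t)) ->
       (forall t, 0 < t -> is_derive v t (k * (M / r t))) ->
       forall t, 0 < t < T ->
         u (r t) t = v t /\ RInt (fun xi => n xi t * xi) 0 (r t) = M).
Proof.
intros [HT [[nc [nr [nt [nrc [ntc nd]]]]] [[uc [ur [ut [urc [utc ud]]]]] [init eqs]]]].
assert (Heq : forall r t, 0 < r -> 0 < t < T ->
  r * Derive (fun s => n r s) t + Derive (fun x => n x t * u x t * x) r = 0 /\
  Derive (fun s => u r s) t + u r t * Derive (fun x => u x t) r
    = - k * Derive (fun x => phi x t) r /\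
  - Derive (fun x => phi x t) r * r = RInt (fun xi => n xi t * xi) 0 r).
{ intros r t Hr Ht. destruct (eqs r t Hr Ht) as [_ [E1 [E2 [_ E3]]]]. auto. }
exists ur. split; [exact urc|]. split; [|split].
- intros r t Hr Ht. now apply ud.
- intros r t Hr Ht.
  apply (is_derive_ext_loc (fun x => mass n x t)).
  + generalize (locally_gt0 r Hr). apply filter_imp. intros x Hx.
    apply mass_eq; lra.
  + evar_last; [apply (mass_derive_r T n nc); rewrite Rabs_pos_eq; lra|].
    unfold mass_density. now rewrite !Rabs_pos_eq by lra.
- intros r v M Hr Hv Hpos Hv0 HM Hrd Hvd t Ht.
  rewrite <- mass_eq by (try (apply Rlt_le, Hpos); lra).
  eapply (solution_along_trajectory k T n0 u0 n u phi nr nt ur ut); eassumption.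
Qed.

(** * Breakdown under the threshold condition *)

(* The last conjunct on alpha excludes only u0'(alpha) = 0 with vacuum on the whole
   of (0, alpha], where nothing happens: for n0 = 0 and u0 = 1 the solution
   n = 0, u = 1 is global. *)
Theorem theorem5p7 (k : R) (n0 u0 : R -> R)
    (hk : 0 < k)
    (hn0 : C1_half_line n0) (hu0 : C1_half_line u0)
    (n0_ge0 : forall r, 0 <= r -> 0 <= n0 r)
    (u0_gt0 : forall r, 0 < r -> 0 < u0 r) :
  (exists alpha : R,
     0 < alpha /\
     Derive u0 alpha <= - sqrt (2 * k * n0 alpha) /\
     ~ (Derive u0 alpha = 0 /\ forall r, 0 < r <= alpha -> n0 r = 0)) ->
  breaks_down_in_finite_time k n0 u0.
Proof.
intros [a [ha [Hcrit Hvac]]].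
destruct hn0 as [n0c _]. destruct hu0 as [u0c [du0 [du0c u0d]]].
pose (m := fun b => RInt (fun xi => n0 xi * xi) 0 b).
pose (dm := fun b => n0 b * b).
assert (Hmc : forall s, continuous (fun xi => n0 (Rabs xi) * xi) s).
{ intros s. apply (continuous_mult (fun xi => n0 (Rabs xi)) (fun xi => xi)).
  - now apply continuous_on_half_line_reflect.
  - apply continuous_id. }
assert (Hmi : forall x y, ex_RInt (fun xi => n0 (Rabs xi) * xi) x y).
{ intros x y. apply (@ex_RInt_continuous R_CompleteNormedModule). auto. }
assert (Hm : forall b, 0 <= b -> m b = RInt (fun xi => n0 (Rabs xi) * xi) 0 b).
{ intros b Hb. apply RInt_ext. intros x Hx. rewrite Rmin_left in Hx by lra.
  now rewrite Rabs_pos_eq by lra. }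
assert (m_derive : forall b, 0 < b -> is_derive m b (dm b)).
{ intros b Hb.
  apply (is_derive_ext_loc (fun b => RInt (fun xi => n0 (Rabs xi) * xi) 0 b)).
  - generalize (locally_gt0 b Hb). apply filter_imp. intros x Hx. symmetry. apply Hm. lra.
  - evar_last.
    + apply (is_derive_RInt (fun xi => n0 (Rabs xi) * xi) _ 0 b); [|apply Hmc].
      apply filter_forall. intros y. apply (@RInt_correct R_CompleteNormedModule), Hmi.
    + unfold dm. now rewrite Rabs_pos_eq by lra. }
assert (m_ge0 : forall b, 0 < b -> 0 <= m b).
{ intros b Hb. rewrite Hm by lra. apply RInt_ge_0; [lra|apply Hmi|].
  intros x Hx. apply Rmult_le_pos; [|lra]. apply n0_ge0, Rabs_pos. }
assert (dm_continuous : forall b, 0 < b -> continuous dm b).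
{ intros b Hb. apply (continuous_mult n0 (fun b => b)); [|apply continuous_id].
  now apply continuous_on_half_line_pos. }
assert (du0_continuous : forall b, 0 < b -> continuous du0 b).
{ intros b Hb. now apply continuous_on_half_line_pos. }
assert (Hda : Derive u0 a = du0 a) by (apply is_derive_unique; auto).
rewrite Hda in Hcrit, Hvac.
pose (X := radius k u0 m).
pose (V := velocity k u0 m).
pose (J := jacobian k u0 du0 m dm).
pose (W := jacobian_rate k u0 du0 m dm).
assert (Xpos : forall b t, 0 < b -> 0 < X b t) by (intros; now apply radius_gt0).
assert (X0 : forall b, 0 < b -> X b 0 = b).
{ intros b Hb. now apply (radius_0 k u0 du0 m dm). }
assert (V0 : forall b, 0 < b -> V b 0 = u0 b).
{ intros b Hb. now apply (velocity_0 k u0 du0 m dm). }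
assert (Xc : forall b t, 0 < b -> continuous (X b) t).
{ intros b t Hb. now apply (continuous_radius k u0 du0 m dm). }
assert (Vc : forall b t, 0 < b -> continuous (V b) t).
{ intros b t Hb. now apply (continuous_velocity k u0 du0 m dm). }
assert (Xd : forall b t, 0 < b -> 0 <= t -> is_derive (X b) t (V b t)).
{ intros b t Hb Ht. now apply (radius_derive k u0 du0 m dm). }
assert (Vd : forall b t, 0 < b -> 0 < t -> is_derive (V b) t (k * (m b / X b t))).
{ intros b t Hb Ht. now apply (velocity_derive k u0 du0 m dm). }
assert (Xdb : forall t, 0 <= t -> is_derive (fun b => X b t) a (J a t)).
{ intros t Ht. now apply radius_derive_b. }
assert (Vdb : forall t, 0 <= t -> is_derive (fun b => V b t) a (W a t)).
{ intros t Ht. now apply velocity_derive_b. }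
assert (Jc : forall t, continuous (J a) t).
{ intros t. now apply continuous_jacobian. }
assert (Wc : forall t, continuous (W a) t).
{ intros t. now apply continuous_jacobian_rate. }
assert (Jd : forall t, 0 < t -> is_derive (J a) t (W a t)).
{ intros t Ht. now apply jacobian_derive. }
assert (Wd : forall t, 0 < t -> is_derive (W a) t
  (k * (n0 a * a) / X a t - k * m a * J a t / X a t ^ 2)).
{ intros t Ht. now apply (jacobian_rate_derive k u0 du0 m dm). }
assert (J0 : J a 0 = 1) by now apply jacobian_0.
assert (W0 : W a 0 = du0 a) by now apply jacobian_rate_0.
assert (Xge : forall t, 0 <= t -> a <= X a t).
{ intros t [Ht| <-]; [|rewrite X0 by exact ha; lra].
  rewrite <- (X0 a ha) at 1.
  apply (derive_nonneg_le (X a) (V a) 0 t Ht).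
  - apply continuous_at_right. now apply Xc.
  - intros s Hs. apply Xd; [exact ha|lra].
  - intros s Hs. apply Rlt_le. now apply velocity_gt0. }
(* If [m a = 0], monotonicity gives [m = 0] on [(0, a]]. A point [r] there with [n0 r > 0] would
   have [m' > 0], making [m] negative just to its left. *)
assert (Hmass : du0 a = 0 -> 0 < m a).
{ intros Hdu. destruct (m_ge0 a ha) as [|Hm0]; [assumption|].
  exfalso. apply Hvac. split; [exact Hdu|]. intros r Hr.
  destruct (n0_ge0 r ltac:(lra)) as [Hpos|]; [exfalso|congruence].
  assert (Hmono : forall x y, 0 < x < y -> m x <= m y).
  { intros x y Hxy.
    apply (derive_nonneg_le m dm x y); [lra| | |].
    - apply continuous_at_right. apply (ex_derive_continuous m). eexists. apply m_derive. lra.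
    - intros z Hz. apply m_derive. lra.
    - intros z Hz. apply Rmult_le_pos; [apply n0_ge0|]; lra. }
  assert (Hmr : m r = 0).
  { destruct (Req_dec r a) as [->|Hne]; [congruence|].
    assert (m r <= m a) by (apply Hmono; lra).
    assert (0 <= m r) by (apply m_ge0; lra). lra. }
  assert (Hdmr : 0 < dm r) by (apply Rmult_lt_0_compat; lra).
  assert (Hs := is_derive_pos_sign m r (dm r) (m_derive r ltac:(lra)) Hdmr).
  destruct (filter_and _ _ Hs (locally_gt0 r ltac:(lra))) as [d Hd].
  pose proof (cond_pos d) as Hd0.
  destruct (Hd (r - d / 2)) as [[_ H1] H2].
  { apply Rabs_lt_ball. apply Rabs_def1; lra. }
  specialize (H1 ltac:(lra)). specialize (m_ge0 _ H2). lra. }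
assert (Hzero : exists t, 0 < t /\ J a t <= 0).
{ apply (exists_nonpos_of_threshold (J a) (W a) (X a) k a (n0 a) (m a)); auto.
  - apply n0_ge0. lra.
  - now rewrite W0.
  - now rewrite W0. }
destruct Hzero as [t1 [Ht1 HJ1]].
destruct (first_zero (J a) t1 Jc ltac:(lra) Ht1 HJ1) as [Tb [HTb [HJTb Jpos]]].
assert (Htraj : trajectories k n0 u0 X).
{ intros b Hb. split; [now apply X0|]. split; [|split].
  - rewrite <- (X0 b Hb) at 2. apply continuous_at_right. now apply Xc.
  - rewrite <- (V0 b Hb).
    apply (filterlim_ext_loc (V b)).
    + exists (mkposreal 1 Rlt_0_1). intros t _ Ht. symmetry.
      apply is_derive_unique. apply Xd; [exact Hb|lra].
    + apply continuous_at_right. now apply Vc.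
  - intros t Ht. split; [now apply Xpos|]. split.
    + eexists. apply Xd; [exact Hb|lra].
    + apply (is_derive_ext_loc (V b)); [|now apply Vd].
      generalize (locally_gt0 t Ht). apply filter_imp. intros s Hs. symmetry.
      apply is_derive_unique. apply Xd; [exact Hb|lra]. }
exists X. split; [exact Htraj|].
exists a, Tb. split; [exact ha|]. split; [exact HTb|].
assert (HDJ : forall t, 0 <= t -> Derive (fun b => X b t) a = J a t).
{ intros t Ht. apply is_derive_unique. now apply Xdb. }
split; [|split; [|split]].
- intros t Ht. eexists. apply Xdb. lra.
- intros t Ht. rewrite HDJ by lra. now apply Jpos.
- rewrite HDJ by lra. exact HJTb.
- intros T n u phi Hsol.
  destruct (smooth_solution_spec _ _ _ _ _ _ _ Hsol) as [ur [urc [urd [Nd Hfollow]]]].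
  assert (Hflow : forall b t, 0 < b -> 0 < t < T ->
    u (X b t) t = V b t /\ RInt (fun xi => n xi t * xi) 0 (X b t) = m b).
  { intros b t Hb Ht.
    apply (Hfollow (X b) (V b) (m b)); auto.
    - rewrite X0 by exact Hb. now apply V0.
    - now rewrite X0 by exact Hb.
    - intros s Hs. apply Xd; [exact Hb|lra]. }
  (* Both sides are the derivative at [b = a] of [u (X b t) t = V b t]. *)
  assert (Hur : forall t, 0 < t < T -> J a t * ur (X a t) t = W a t).
  { intros t Ht.
    assert (H1 : is_derive (fun b => u (X b t) t) a (J a t * ur (X a t) t)).
    { apply (is_derive_comp (fun x => u x t) (fun b => X b t)).
      - apply urd; [now apply Xpos|exact Ht].
      - apply Xdb. lra. }
    assert (H2 : is_derive (fun b => u (X b t) t) a (W a t)).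
    { apply (is_derive_ext_loc (fun b => V b t)); [|apply Vdb; lra].
      generalize (locally_gt0 a ha). apply filter_imp. intros b Hb.
      symmetry. now apply Hflow. }
    apply is_derive_unique in H1. apply is_derive_unique in H2. congruence. }
  (* Both sides are the derivative at [b = a] of the mass enclosed by the trajectory, which keeps
     its initial value [m b]. *)
  assert (Hn : forall t, 0 < t < T -> J a t * (n (X a t) t * X a t) = n0 a * a).
  { intros t Ht.
    assert (H1 : is_derive (fun b => RInt (fun xi => n xi t * xi) 0 (X b t)) a
                   (J a t * (n (X a t) t * X a t))).
    { apply (is_derive_comp (fun x => RInt (fun xi => n xi t * xi) 0 x) (fun b => X b t)).
      - apply Nd; [now apply Xpos|exact Ht].
      - apply Xdb. lra. }
    assert (H2 : is_derive (fun b => RInt (fun xi => n xi t * xi) 0 (X b t)) a (dm a)).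
    { apply (is_derive_ext_loc m); [|now apply m_derive].
      generalize (locally_gt0 a ha). apply filter_imp. intros b Hb.
      symmetry. now apply Hflow. }
    apply is_derive_unique in H1. apply is_derive_unique in H2. unfold dm in H2. congruence. }
  assert (Hunb : Tb <= T -> unbounded_before Tb (fun t => ur (X a t) t)).
  { intros HTbT. apply (log_derivative_unbounded (J a) (W a)); auto.
    intros t Ht. apply Hur. lra. }
  split; [|split].
  (* A solution living beyond [Tb] would have [u_r] continuous, hence bounded, along the path on the
     compact interval [[0, Tb]]. *)
  + apply Rnot_lt_le. intros HTbT.
    destruct (continuous_abs_bounded (fun t => ur (Rabs (X a t)) (Rabs t)) 0 Tb ltac:(lra))
      as [C [_ HC]].
    { intros t Ht. apply (continuous_strip_along T); auto. rewrite Rabs_pos_eq; lra. }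
    destruct (Hunb (Rlt_le _ _ HTbT) C) as [t [Ht HCt]].
    specialize (HC t ltac:(lra)). assert (HX := Xpos a t ha).
    simpl in HC. rewrite (Rabs_pos_eq (X a t)), (Rabs_pos_eq t) in HC by lra. lra.
  + intros b Hb. split; [now apply X0|]. split.
    * rewrite <- (X0 b Hb) at 2. apply continuous_at_right. now apply Xc.
    * intros t Ht. split; [now apply Xpos|].
      rewrite (proj1 (Hflow b t Hb Ht)). apply Xd; [exact Hb|lra].
  + intros ->. split.
    * intros M. destruct (Hunb (Rle_refl _) M) as [t [Ht HMt]].
      exists t. split; [exact Ht|].
      assert (E : Derive (fun x => u x t) (X a t) = ur (X a t) t).
      { apply is_derive_unique. apply urd; [now apply Xpos|exact Ht]. }
      now rewrite E.
    * intros Hn0 M.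
      destruct (continuous_abs_bounded (X a) 0 Tb ltac:(lra)) as [K [HK0 HK]]; [auto|].
      assert (HM := Rabs_pos M).
      (* Since [n = n0 a * a / (J * X)] along the path and [X <= K], a Jacobian below this bound
         forces [n] to be at least [Rabs M + 1]. *)
      assert (He : 0 < n0 a * a / ((Rabs M + 1) * (K + 1))).
      { apply Rdiv_lt_0_compat; apply Rmult_lt_0_compat; lra. }
      destruct (exists_small_before (J a) Tb _ Jc HTb HJTb He) as [t [Ht HJt]].
      exists t. split; [exact Ht|].
      assert (HXt := HK t ltac:(lra)). assert (HX := Xpos a t ha).
      rewrite (Rabs_pos_eq (X a t)) in HXt by lra.
      specialize (Hn t Ht). assert (HJ := Jpos t ltac:(lra)).
      apply Rlt_le_trans with (Rabs M + 1); [unfold Rabs; destruct Rcase_abs; lra|].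
      apply Rle_trans with (n (X a t) t); [|apply Rle_abs].
      apply Rnot_lt_le. intros Hlt.
      assert (HJ2 : J a t * ((Rabs M + 1) * (K + 1)) < n0 a * a).
      { apply (Rmult_lt_compat_r ((Rabs M + 1) * (K + 1))) in HJt;
          [|apply Rmult_lt_0_compat; lra].
        unfold Rdiv in HJt. rewrite Rmult_assoc, Rinv_l, Rmult_1_r in HJt; [exact HJt|].
        apply Rgt_not_eq. apply Rmult_lt_0_compat; lra. }
      assert (n (X a t) t * X a t <= (Rabs M + 1) * (K + 1)).
      { apply Rle_trans with ((Rabs M + 1) * X a t).
        - apply Rmult_le_compat_r; lra.
        - apply Rmult_le_compat_l; lra. }
      assert (J a t * (n (X a t) t * X a t) <= J a t * ((Rabs M + 1) * (K + 1)))
        by (apply Rmult_le_compat_l; lra).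
      lra.
Qed.
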